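(* Let $X$ and $Y$ be infinite dimensional complex Banach spaces. Let $\varphi:\mathcal{B}(X)\to\mathcal{B}(Y)$ be an additive surjective map that preserves either the minimum modulus (i.e. $\mathrm{m}(\varphi(T))=\mathrm{m}(T)$ for all $T\in\mathcal{B}(X)$) or the surjectivity modulus (i.e. $\mathrm{q}(\varphi(T))=\mathrm{q}(T)$ for all $T\in\mathcal{B}(X)$). Then one of the following holds: (1) there are bijective isometries $U:X\to Y$ and $V:Y\to X$, both linear or both conjugate linear, such that $\varphi(T)=UTV$ for all $T\in\mathcal{B}(X)$; or (2) there are bijective isometries $U:X^*\to Y$ and $V:Y\to X^*$, both linear or both conjugate linear, such that $\varphi(T)=UT^*V$ for all $T\in\mathcal{B}(X)$.
   Context: For a complex Banach space $Z$, $\mathcal{B}(Z)$ denotes the algebra of all bounded linear operators on $Z$, $Z^*$ its (topological) dual space, and $B_Z$ its closed unit ball. A map $\varphi$ is additive if $\varphi(S+T)=\varphi(S)+\varphi(T)$ for all $S,T$ (no homogeneity is assumed). For $T\in\mathcal{B}(X)$, $T^*\in\mathcal{B}(X^* )$ is the Banach space adjoint of $T$. A map $U$ between complex vector spaces is conjugate linear if it is additive and $U(\lambda x)=\overline{\lambda}Ux$ for all scalars $\lambda$ and vectors $x$. For $T\in\mathcal{B}(Z)$, the minimum modulus and the surjectivity modulus of $T$ are respectively $$\mathrm{m}(T):=\inf\{\|Tz\|:\ z\in Z,\ \|z\|=1\},\qquad \mathrm{q}(T):=\sup\{\varepsilon\geq 0:\ \varepsilon B_Z\subseteq T(B_Z)\}.$$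 *)

(* Defs.v *)
From HB Require Import structures.
From mathcomp Require Import all_boot all_order all_algebra.
From mathcomp Require Import complex.
From mathcomp Require Import all_classical all_reals all_analysis.

Set Implicit Arguments.
Unset Strict Implicit.
Unset Printing Implicit Defensive.

Import Order.TTheory GRing.Theory Num.Theory.
Import numFieldNormedType.Exports.

Local Open Scope classical_set_scope.
Local Open Scope ring_scope.
Local Open Scope complex_scope.

(* A complex Banach space is a completeNormedModType R[i] with R : realType.
   Its norm `|x| takes values in R[i] (with zero imaginary part), so infima and
   suprema of norms are taken in R, through rnorm. *)
Definition rnorm (R : realType) (V : normedModType R[i]) (x : V) : R :=
  complex.Re `|x|.

Section RNorm.
Variables (R : realType) (V : normedModType R[i]).
Implicit Types x y : V.

Lemma rnormE x : (rnorm x)%:C = `|x|.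
Proof. by rewrite /rnorm RRe_real// realE normr_ge0. Qed.

Lemma rnorm_ge0 x : 0 <= rnorm x.
Proof. by rewrite -ler0c rnormE. Qed.

Lemma rnorm0 : rnorm (0 : V) = 0.
Proof. by apply: complexI; rewrite rnormE normr0. Qed.

Lemma rnorm0_eq0 x : rnorm x = 0 -> x = 0.
Proof. by move=> x0; apply/normr0_eq0; rewrite -rnormE x0. Qed.

Lemma ler_rnormD x y : rnorm (x + y) <= rnorm x + rnorm y.
Proof. by rewrite -lecR rmorphD/= !rnormE ler_normD. Qed.

Lemma rnormZ (a : R[i]) x : rnorm (a *: x) = complex.Re `|a| * rnorm x.
Proof.
by apply: complexI; rewrite rmorphM/= !rnormE normrZ.
Qed.

End RNorm.

Section BoundedOperators.
Variables (R : realType) (V W : normedModType R[i]).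
Implicit Types f g : V -> W.

Definition bounded_linear : {pred V -> W} := fun f =>
  `[< linear f /\ exists M : R, forall x, rnorm (f x) <= M * rnorm x >].

Lemma bounded_linear_submod_closed : submod_closed bounded_linear.
Proof.
split.
  apply/asboolP; split; first by move=> a u v; rewrite scaler0 addr0.
  by exists 0 => x; rewrite mul0r rnorm0.
move=> c f g /asboolP[lf [M fM]] /asboolP[lg [N gN]]; apply/asboolP; split.
  move=> a u v; rewrite !fctE lf lg !scalerDr !scalerA [c * a]mulrC.
  by rewrite addrACA.
exists (complex.Re `|c| * M + N) => x.
rewrite !fctE (le_trans (ler_rnormD _ _))// mulrDl lerD// rnormZ -mulrA.
by rewrite ler_wpM2l//; exact: (@rnorm_ge0 _ R[i]^o).
Qed.

HB.instance Definition _ :=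
  GRing.isSubmodClosed.Build R[i] (V -> W) bounded_linear
    bounded_linear_submod_closed.

Record bounded_operator := BoundedOperator {
  bounded_operator_val :> V -> W;
  _ : bounded_operator_val \in bounded_linear }.

HB.instance Definition _ := [isSub for bounded_operator_val].
HB.instance Definition _ := [Choice of bounded_operator by <:].
HB.instance Definition _ :=
  [SubChoice_isSubLmodule of bounded_operator by <:].

Lemma bounded_operatorP (f : bounded_operator) :
  linear f /\ exists M : R, forall x, rnorm (f x) <= M * rnorm x.
Proof. by case: f => f /= /asboolP. Qed.

HB.instance Definition _ (f : bounded_operator) :=
  GRing.isLinear.Build R[i] V W *:%R f (bounded_operatorP f).1.

Lemma bounded_operator_eq (f g : bounded_operator) : f =1 g -> f = g.
Proof. by move=> fg; apply/val_inj/funext. Qed.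

Definition opnorm (f : bounded_operator) : R :=
  sup [set rnorm (f x) | x in [set x | `|x| <= 1]].

Lemma opnorm_has_sup (f : bounded_operator) :
  has_sup [set rnorm (f x) | x in [set x | `|x| <= 1]].
Proof.
split; first by exists (rnorm (f 0)), 0 => //=; rewrite normr0.
have [_ [M fM]] := bounded_operatorP f.
exists `|M| => _ [x /= x1 <-]; rewrite (le_trans (fM x))//.
rewrite (le_trans (ler_wpM2r (rnorm_ge0 x) (ler_norm M)))//.
by rewrite ler_piMr// -lecR rnormE.
Qed.

Lemma opnorm_ub (f : bounded_operator) x : `|x| <= 1 -> rnorm (f x) <= opnorm f.
Proof.
by move=> x1; apply: (ub_le_sup (opnorm_has_sup f).2); exists x.
Qed.

Lemma opnorm_le (f : bounded_operator) (M : R) :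
  (forall x, `|x| <= 1 -> rnorm (f x) <= M) -> opnorm f <= M.
Proof.
move=> fM; apply: ge_sup; first exact: (opnorm_has_sup f).1.
by move=> _ [x /= x1 <-]; exact: fM.
Qed.

Lemma opnorm_ge0 (f : bounded_operator) : 0 <= opnorm f.
Proof.
by rewrite (le_trans (rnorm_ge0 (f 0)))// opnorm_ub// normr0.
Qed.

Lemma opnormP (f : bounded_operator) x : rnorm (f x) <= opnorm f * rnorm x.
Proof.
have [->|x0] := eqVneq x 0; first by rewrite linear0 !rnorm0 mulr0.
have rx0 : 0 < rnorm x.
  rewrite lt_neqAle rnorm_ge0 andbT eq_sym; apply: contra x0 => /eqP.
  by move/rnorm0_eq0 ->.
have nx : `| `|x|^-1 | = `|x|^-1 by rewrite normfV normr_id.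
have := @opnorm_ub f (`|x|^-1 *: x).
rewrite normrZ nx mulVf ?normr_eq0// => /(_ (lexx _)).
rewrite linearZ/= rnormZ nx -rnormE.
rewrite -[(_%:C)^-1](fmorphV (real_complex R)) /=.
by rewrite mulrC ler_pdivrMr.
Qed.

Lemma opnorm0_eq0 (f : bounded_operator) : (opnorm f)%:C = 0 -> f = 0.
Proof.
move=> /complexI f0; apply: bounded_operator_eq => x; apply: rnorm0_eq0.
by apply/le_anti; rewrite rnorm_ge0 andbT (le_trans (opnormP f x))// f0 mul0r.
Qed.

Lemma ler_opnormD (f g : bounded_operator) :
  (opnorm (f + g))%:C <= (opnorm f)%:C + (opnorm g)%:C.
Proof.
rewrite -rmorphD lecR; apply: opnorm_le => x x1.
by rewrite (le_trans (ler_rnormD (f x) (g x)))// lerD// opnorm_ub.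
Qed.

Lemma opnormZ (a : R[i]) (f : bounded_operator) :
  (opnorm (a *: f))%:C = `|a| * (opnorm f)%:C.
Proof.
have leZ (b : R[i]) (h : bounded_operator) :
    opnorm (b *: h) <= complex.Re `|b| * opnorm h.
  apply: opnorm_le => x x1; rewrite (rnormZ b (h x)) ler_wpM2l ?opnorm_ub//.
  exact: (@rnorm_ge0 _ R[i]^o).
rewrite -[`|a|](@RRe_real R) ?realE ?normr_ge0//.
rewrite -(rmorphM (real_complex R)); congr _%:C; apply/le_anti; rewrite leZ andTb.
have [->|a0] := eqVneq a 0; first by rewrite normr0 mul0r opnorm_ge0.
have := leZ a^-1 (a *: f); rewrite scalerA mulVf// scale1r normfV.
have ra0 : 0 < complex.Re `|a|.
  by rewrite -ltcR RRe_real ?realE ?normr_ge0// normr_gt0.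
rewrite -{1}[`|a|](@RRe_real R) ?realE ?normr_ge0//.
rewrite -[(_%:C)^-1](fmorphV (real_complex R)) /=.
by rewrite ler_pdivlMl.
Qed.

HB.instance Definition _ := @Lmodule_isNormed.Build R[i] bounded_operator
  (fun f : bounded_operator => (opnorm f)%:C) ler_opnormD opnormZ opnorm0_eq0.

End BoundedOperators.

Arguments bounded_linear {R V W}.

Notation "''B' ( V , W )" := (bounded_operator V W)
  (at level 8, format "''B' ( V ,  W )") : type_scope.
Notation "''B' ( V )" := (bounded_operator V V)
  (at level 8, format "''B' ( V )") : type_scope.
Notation dual V := (bounded_operator V (complex _)^o).

Lemma bounded_operator_normE (R : realType) (V W : normedModType R[i])
  (f : 'B(V, W)) : `|f| = (opnorm f)%:C.
Proof. by []. Qed.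

Section Adjoint.
Variables (R : realType) (V W : normedModType R[i]) (T : 'B(V, W)).

Lemma dual_comp_bounded_linear (f : dual W) :
  (f \o T : V -> R[i]^o) \in bounded_linear.
Proof.
apply/asboolP; split; first by move=> a u v; rewrite /= !linearP.
exists (opnorm f * opnorm T) => x.
rewrite (le_trans (opnormP f (T x)))// -mulrA.
by rewrite ler_wpM2l ?opnorm_ge0// opnormP.
Qed.

Definition adjoint_fun (f : dual W) : dual V :=
  BoundedOperator (dual_comp_bounded_linear f).

Lemma adjoint_bounded_linear : adjoint_fun \in bounded_linear.
Proof.
apply/asboolP; split.
  by move=> a f g; apply: bounded_operator_eq => x.
exists (opnorm T) => f; rewrite /rnorm !bounded_operator_normE /=.
apply: opnorm_le => x x1; rewrite (le_trans (opnormP f (T x)))// mulrC.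
by rewrite ler_wpM2r ?opnorm_ge0// opnorm_ub.
Qed.

Definition adjoint : 'B(dual W, dual V) :=
  BoundedOperator adjoint_bounded_linear.

Lemma adjointE (f : dual W) (x : V) : adjoint f x = f (T x).
Proof. by []. Qed.

End Adjoint.

Section Moduli.
Variables (R : realType) (Z : normedModType R[i]).

Definition unit_ball : set Z := [set z | `|z| <= 1].

(* inf and sup are those of R: they are 0 on an empty or unbounded set, which
   happens here only when Z is the zero space. *)
Definition minimum_modulus (T : 'B(Z)) : R :=
  inf [set rnorm (T z) | z in [set z | `|z| = 1]].

Definition surjectivity_modulus (T : 'B(Z)) : R :=
  sup [set e : R | 0 <= e /\
    [set e%:C *: z | z in unit_ball] `<=` T @` unit_ball].

Definition infinite_dimensional : Prop :=
  ~ exists (n : nat) (e : 'I_n -> Z), forall z : Z,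
      exists c : 'I_n -> R[i], z = \sum_(i < n) c i *: e i.

End Moduli.

Section Maps.
Variables (R : realType) (V W : normedModType R[i]).

Definition isometric (f : V -> W) : Prop :=
  forall x y : V, `|f x - f y| = `|x - y|.

Definition conjugate_linear (f : V -> W) : Prop :=
  {morph f : x y / x + y} /\
  forall (a : R[i]) (x : V), f (a *: x) = a^* *: f x.

End Maps.

(* Main.v *)
Require Import Defs.
From mathcomp Require Import all_boot all_order all_algebra.
From mathcomp Require Import complex.
From mathcomp Require Import all_classical all_reals all_analysis.
From mathcomp Require Import ring lra.

Import Order.TTheory GRing.Theory Num.Theory.
Import numFieldNormedType.Exports.

Local Open Scope classical_set_scope.
Local Open Scope ring_scope.
Local Open Scope complex_scope.

Set Implicit Arguments.
Unset Strict Implicit.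
Unset Printing Implicit Defensive.

(** Write [mu] for the minimum modulus or the surjectivity modulus, and [u (x) f]
for the operator [x |-> f x u].

The modulus and the addition determine two things that they do not mention. The
first is the norm: [mu] is 1-Lipschitz, and [mu T - mu (T + A)] comes close to the
norm of [A] for a suitable invertible [T] ([modulus_norming]). So [phi] is an
isometry, hence injective. The second is whether [A] has rank at most one: if [T]
has positive modulus and [A = u (x) f], then [T + c A] has modulus zero for at most
one scalar [c], whereas for [A] of rank at least two some invertible [T] makes
[T + A] and [T + 2 A] both non-injective and non-surjective
([rank_ge2_singular_shifts]). So [phi] preserves rank at most one in both
directions.

An additive family of operators of rank at most one has a common image or a common
kernel. Applied to [x (x) f] with [x] fixed and with [f] fixed, this shows that
either [phi (x (x) f) = U x (x) C f] for all [x] and [f], or [phi (x (x) f) = U f (x) C x]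
([rank_one_preserver_form]). Because [phi] is an isometry, [U] and [C] are isometric,
and multiplication by [i] goes to multiplication by [i] or by [- i]: both maps are
linear, or both are conjugate linear. The two cases are treated together, by
allowing the rank-one operators to be parametrised in either order.

If [T] is invertible then [T + x (x) f] has modulus zero exactly when
[f (T^-1 x) = -1]. In the first case, transporting this by [phi] shows that [phi T] is
invertible and that [C f ((phi T)^-1 U x)] equals [f (T^-1 x)], up to conjugation.
Since the functionals [C f] separate points, this determines [phi T]: with
[V = U^-1 phi 1] it is [U T V]. In the second case the same argument gives
[U T^* V]. Every operator is a difference of two invertible ones, so the formula
holds for all [T].

What is used of the moduli is collected in the record [modulus], which both of them
satisfy ([modulus_minimum], [modulus_surjectivity]). For the minimum modulus the main
point is that operators bounded below have closed range; for the surjectivity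
modulus, that openness survives small perturbations ([onto_perturb]). Functionals
are supplied by the complex Hahn-Banach theorem ([norming_functional]). *)

(** * Norms with real values *)

Notation cmod a := (@rnorm _ (complex _)^o a).

Section RNormTheory.
Variables (R : realType) (V : normedModType R[i]).
Implicit Types (x y z : V) (a b : R[i]) (r : R).

Lemma rnormE_le x r : (`|x| <= r%:C) = (rnorm x <= r).
Proof. by rewrite -rnormE lecR. Qed.

Lemma rnorm_eq x r : (`|x| = r%:C) <-> (rnorm x = r).
Proof. by rewrite -rnormE; split=> [/complexI|->]. Qed.

Lemma rnorm_scale a x : rnorm (a *: x) = cmod a * rnorm x.
Proof. exact: rnormZ. Qed.

Lemma rnormN x : rnorm (- x) = rnorm x.
Proof. by rewrite /rnorm normrN. Qed.

Lemma rnormB x y : rnorm (x - y) = rnorm (y - x).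
Proof. by rewrite /rnorm distrC. Qed.

Lemma rnorm_eq0 x : (rnorm x == 0) = (x == 0).
Proof. by apply/eqP/eqP => [/rnorm0_eq0//|->]; rewrite rnorm0. Qed.

Lemma rnorm_gt0 x : (0 < rnorm x) = (x != 0).
Proof. by rewrite lt_neqAle rnorm_ge0 andbT eq_sym rnorm_eq0. Qed.

Lemma rnorm_leB x y : rnorm x - rnorm y <= rnorm (x + y).
Proof.
rewrite lerBlDr -(rnormN y) (le_trans _ (ler_rnormD _ _))//.
by rewrite addrK.
Qed.

Lemma cmodM a b : cmod (a * b) = cmod a * cmod b.
Proof. exact: (@rnormZ _ R[i]^o). Qed.

Lemma cmod1 : cmod (1 : R[i]) = 1.
Proof. by rewrite /rnorm normr1. Qed.

Lemma cmodR r : cmod (r%:C) = `|r|.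
Proof. by rewrite /rnorm normc_def/= expr0n/= addr0 sqrtr_sqr. Qed.

Lemma cmod_eq0 a : (cmod a == 0) = (a == 0).
Proof. by apply/eqP/eqP => [/(@rnorm0_eq0 _ R[i]^o)//|->]; exact: rnorm0. Qed.

Lemma cmod_gt0 a : (0 < cmod a) = (a != 0).
Proof. by rewrite lt_neqAle (@rnorm_ge0 _ R[i]^o) andbT eq_sym cmod_eq0. Qed.

Lemma cmod0 : cmod (0 : R[i]) = 0.
Proof. exact: (@rnorm0 _ R[i]^o). Qed.

Lemma cmod_ge0 a : 0 <= cmod a.
Proof. exact: (@rnorm_ge0 _ R[i]^o). Qed.

Lemma cmodV a : cmod a^-1 = (cmod a)^-1.
Proof.
have [->|a0] := eqVneq a 0; first by rewrite invr0 cmod0 invr0.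
have ca0 : cmod a != 0 by rewrite cmod_eq0.
by apply: (mulfI ca0); rewrite -cmodM divff// cmod1 divff.
Qed.

Lemma cmod_sqr a : cmod a ^+ 2 = complex.Re a ^+ 2 + complex.Im a ^+ 2.
Proof.
rewrite /rnorm normc_def/= sqr_sqrtr ?addr_ge0 ?sqr_ge0//.
Qed.

Lemma cmod_conj a : cmod a^* = cmod a.
Proof.
apply/eqP; rewrite -(eqrXn2 (n := 2)) ?cmod_ge0// !cmod_sqr.
by case: a => u v /=; rewrite sqrrN.
Qed.

Lemma rnorm_pscale r x : 0 <= r -> rnorm (r%:C *: x) = r * rnorm x.
Proof. by move=> r0; rewrite rnorm_scale cmodR ger0_norm. Qed.

Lemma rnorm_normal x : x != 0 -> rnorm ((rnorm x)^-1%:C *: x) = 1.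
Proof.
move=> x0; rewrite rnorm_scale cmodR ger0_norm ?invr_ge0 ?rnorm_ge0//.
by rewrite mulVf// rnorm_eq0.
Qed.

End RNormTheory.

(** * The Hahn-Banach theorem over the complex field *)

Section HahnBanach.
Variables (R : realType) (V : normedModType R[i]).
Implicit Types (x y z : V) (r s t : R).

Definition sublinear (p : V -> R) :=
  (forall x y, p (x + y) <= p x + p y) /\
  (forall r x, 0 <= r -> p (r%:C *: x) = r * p x).

Lemma sublinear_rnorm : sublinear (@rnorm R V).
Proof.
split=> [x y|r x r0]; first exact: ler_rnormD.
by rewrite rnorm_scale cmodR ger0_norm.
Qed.

Lemma sublinear0 p : sublinear p -> p 0 = 0.
Proof. by move=> [_ /(_ 0 0 (lexx _))]; rewrite scaler0 mul0r. Qed.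

Lemma sublinear_geN p x : sublinear p -> - p (- x) <= p x.
Proof.
move=> sp; rewrite lerNl -subr_ge0 opprK addrC.
by have := sp.1 x (- x); rewrite subrr sublinear0.
Qed.

Section Chain.
Variable (A : set (V -> R)).
Hypotheses (A0 : A !=set0) (subA : forall p, A p -> sublinear p).
Hypothesis totA : forall p q, A p -> A q ->
  (forall x, p x <= q x) \/ (forall x, q x <= p x).
Let m x := inf [set p x | p in A].

Let has_infA q x : A q -> sublinear q -> has_inf [set p x | p in A].
Proof.
move=> Aq sq; split; first by exists (q x), q.
exists (- q (- x)) => _ [p Ap <-].
have [pq|qp] := totA Ap Aq.
  rewrite (le_trans _ (sublinear_geN x (subA Ap)))// lerN2//.
by rewrite (le_trans (sublinear_geN x sq)).
Qed.

Lemma chain_inf_le p x : A p -> m x <= p x.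
Proof.
by move=> Ap; apply: ge_inf; [exact: (has_infA x Ap (subA Ap)).2|exists p].
Qed.

Let ge_m r x : (forall p, A p -> r <= p x) -> r <= m x.
Proof.
move=> h; apply: lb_le_inf; last by move=> _ [p Ap <-]; exact: h.
by have [p Ap] := A0; exists (p x), p.
Qed.

(** Subadditivity is where the chain matters: a bound for [p x + q y] with two
different members of the chain follows from the one for the smaller member. *)
Lemma chain_inf_sublinear : sublinear m.
Proof.
split=> [x y|r x r0].
  rewrite -lerBlDr; apply: ge_m => p Ap; rewrite lerBlDl -lerBlDr.
  apply: ge_m => q Aq; rewrite lerBlDl.
  have [pq|qp] := totA Ap Aq.
    apply: (le_trans (chain_inf_le _ Ap)); apply: (le_trans ((subA Ap).1 x y)).
    by have := pq y; lra.
  apply: (le_trans (chain_inf_le _ Aq)); apply: (le_trans ((subA Aq).1 x y)).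
  by have := qp x; lra.
have [->|rn0] := eqVneq r 0.
  rewrite mul0r; have -> : 0%:C *: x = 0 by rewrite scale0r.
  apply/le_anti/andP; split.
    by have [p Ap] := A0; rewrite -(sublinear0 (subA Ap)) chain_inf_le.
  by apply: ge_m => p Ap; rewrite (sublinear0 (subA Ap)).
have rp : 0 < r by rewrite lt_neqAle eq_sym rn0.
apply/le_anti/andP; split.
  rewrite -ler_pdivrMl//; apply: ge_m => p Ap; rewrite ler_pdivrMl//.
  by rewrite -(subA Ap).2// chain_inf_le.
by apply: ge_m => p Ap; rewrite (subA Ap).2// ler_wpM2l// chain_inf_le.
Qed.

End Chain.

Section Directional.
Variables (q : V -> R) (y : V).
Hypothesis sq : sublinear q.
(** This is the largest sublinear functional below [q] that is at most [- q y] at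
[- y]: a [q] that cannot be lowered in this way is additive in the direction
[y]. *)
Definition descent x :=
  inf [set q (x + t%:C *: y) - t * q y | t in [set t | 0 <= t]].

Let lbd x t : 0 <= t -> - q (- x) <= q (x + t%:C *: y) - t * q y.
Proof.
move=> t0; rewrite -sq.2//.
have := sq.1 (x + t%:C *: y) (- x); rewrite addrAC subrr add0r.
lra.
Qed.

Lemma descent_le x t : 0 <= t -> descent x <= q (x + t%:C *: y) - t * q y.
Proof.
move=> t0; apply: ge_inf; last by exists t.
by exists (- q (- x)) => _ [s s0 <-]; exact: lbd.
Qed.

Let ge_d r x : (forall t, 0 <= t -> r <= q (x + t%:C *: y) - t * q y) ->
  r <= descent x.
Proof.
move=> h; apply: lb_le_inf; last by move=> _ [t t0 <-]; exact: h.
by exists (q (x + 0%:C *: y) - 0 * q y), 0 => //=; exact: lexx.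
Qed.

Lemma descent_sublinear : sublinear descent.
Proof.
split=> [x z|r x r0].
  rewrite -lerBlDr; apply: ge_d => t t0; rewrite lerBlDl -lerBlDr.
  apply: ge_d => s s0; rewrite lerBlDl.
  apply: (le_trans (descent_le _ (addr_ge0 t0 s0))).
  have -> : x + z + (t + s)%:C *: y = (x + t%:C *: y) + (z + s%:C *: y).
    by rewrite rmorphD/= scalerDl addrACA.
  have := sq.1 (x + t%:C *: y) (z + s%:C *: y); lra.
have [->|rn0] := eqVneq r 0.
  rewrite mul0r; have -> : 0%:C *: x = 0 by rewrite scale0r.
  apply/le_anti/andP; split.
    rewrite (le_trans (descent_le _ (lexx 0)))//.
    by rewrite scale0r addr0 sublinear0// mul0r subr0.
  by apply: ge_d => t t0; rewrite add0r sq.2// subrr.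
have rp : 0 < r by rewrite lt_neqAle eq_sym rn0.
apply/le_anti/andP; split.
  rewrite -ler_pdivrMl//; apply: ge_d => t t0; rewrite ler_pdivrMl//.
  apply: (le_trans (descent_le _ (mulr_ge0 r0 t0))).
  by rewrite rmorphM/= -scalerA -scalerDr sq.2// mulrBr mulrA.
apply: ge_d => t t0.
have -> : r%:C *: x + t%:C *: y = r%:C *: (x + (t / r)%:C *: y).
  by rewrite scalerDr scalerA -rmorphM/= mulrCA divff ?mulr1.
have -> : t * q y = r * (t / r * q y) by rewrite mulrA mulrCA divff ?mulr1.
rewrite sq.2// -mulrBr ler_wpM2l// descent_le// divr_ge0//.
Qed.

Lemma descent_le_self x : descent x <= q x.
Proof.
rewrite (le_trans (descent_le _ (lexx 0)))//.
by rewrite scale0r addr0 mul0r subr0.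
Qed.

End Directional.

(** A minimal sublinear functional below [p], given by Zorn's lemma, is fixed by
every [descent], which forces it to be additive. No partially defined
functionals have to be extended. *)
Lemma sublinear_minorant p : sublinear p ->
  exists g : V -> R, [/\ forall x, g x <= p x, {morph g : x y / x + y} &
    forall r x, g (r%:C *: x) = r * g x].
Proof.
move=> sp.
pose T := {q : V -> R | sublinear q /\ forall x, q x <= p x}.
pose mkT q (sq : sublinear q) (qp : forall x, q x <= p x) : T :=
  exist _ q (conj sq qp).
pose le (q q' : T) := `[< forall x, sval q' x <= sval q x >].
have [||||g gmin] := @Zorn T le.
- by move=> q; apply/asboolP.
- move=> q r s /asboolP qr /asboolP rs; apply/asboolP => x.
  exact: le_trans (rs x) (qr x).
- move=> [q hq] [r hr] /asboolP/= qr /asboolP/= rq.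
  apply: eq_exist => /=; apply/funext => x; apply/le_anti.
  by rewrite qr rq.
- move=> A totA.
  have [[q0 Aq0]|A0] := pselect (A !=set0); last first.
    exists (mkT _ sp (fun x => lexx _)) => s As.
    by exfalso; apply: A0; exists s.
  pose B := [set sval q | q in A].
  have B0 : B !=set0 by exists (sval q0), q0.
  have sB q : B q -> sublinear q by move=> [[q' [? ?]] _ <-].
  have tB (q q1 : V -> R) : B q -> B q1 ->
      (forall x, q x <= q1 x) \/ (forall x, q1 x <= q x).
    move=> [q' Aq <-] [r' Ar <-].
    by have [/asboolP|/asboolP] := totA _ _ Aq Ar; [right|left].
  have le_p x : inf [set q x | q in B] <= p x.
    have Bq0 : B (sval q0) by exists q0.
    apply: (le_trans (chain_inf_le sB tB x Bq0)).
    by case: (q0) => /= q' [].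
  exists (mkT _ (chain_inf_sublinear B0 sB tB) le_p) => s As.
  apply/asboolP => x /=.
  by apply: (chain_inf_le sB tB x); exists s.
case: g gmin => g [sg gp] gmin.
have add x y : g (x + y) = g x + g y.
  have le1 z : descent g y z <= p z := le_trans (descent_le_self y sg z) (gp z).
  have e : descent g y = g :=
    congr1 sval (gmin (mkT _ (descent_sublinear y sg) le1)
    (asboolT (fun z => descent_le_self y sg z))).
  apply/le_anti; rewrite sg.1/=.
  have := descent_le y sg x ler01; rewrite e scale1r mul1r; lra.
exists g; split => // r x.
have [r0|r0] := leP 0 r; first exact: sg.2.
have gN z : g (- z) = - g z.
  by have := add z (- z); rewrite subrr (sublinear0 sg); lra.
rewrite -[r]opprK rmorphN/= scaleNr gN sg.2 ?mulNr//.
by rewrite oppr_ge0 ltW.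
Qed.

(** Taking [a] to be the conjugate of [c] makes [a * c] the square of the modulus
of [c]. *)
Lemma cmodC_le (c : R[i]) (M : R) : 0 <= M ->
  (forall a : R[i], complex.Re (a * c) <= cmod a * M) -> cmod c <= M.
Proof.
move=> M0 h.
have [->|c0] := eqVneq c 0; first by rewrite cmod0.
have cp : 0 < cmod c by rewrite cmod_gt0.
rewrite -(ler_pM2l cp).
have := h c^*; rewrite cmod_conj.
suff -> : complex.Re (c^* * c) = cmod c ^+ 2 by [].
by rewrite cmod_sqr; case: (c) => u v /=; ring.
Qed.

(** The functional is [x |-> g x - i g (i x)], where [g] is a real-linear minorant of
the norm. Starting the descent from the norm in the direction [x0] makes [g]
take the value [rnorm x0] at [x0]; since the modulus at [x0] cannot exceed
[rnorm x0], the imaginary part vanishes there. *)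
Lemma norming_functional x0 :
  exists2 f : dual V, opnorm f <= 1 & f x0 = (rnorm x0)%:C.
Proof.
have [g [gp gD gZ]] :=
  sublinear_minorant (descent_sublinear x0 sublinear_rnorm).
have gle x : g x <= rnorm x.
  exact: le_trans (gp x) (descent_le_self x0 sublinear_rnorm x).
have gN x : g (- x) = - g x.
  by have := gZ (-1) x; rewrite rmorphN1 scaleN1r mulN1r.
have gx0 : g x0 = rnorm x0.
  apply/le_anti; rewrite gle/=.
  have := le_trans (gp (- x0)) (descent_le x0 sublinear_rnorm (- x0) ler01).
  by rewrite scale1r addNr rnorm0 gN mul1r; lra.
pose f x : R[i]^o := (g x) +i* (- g ('i *: x)).
have fE x : f x = (g x) +i* (- g ('i *: x)) by [].
have lf : linear f.
  have fD x y : f (x + y) = f x + f y.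
    rewrite !fE scalerDr !gD/= opprD.
    by apply/eqP; rewrite eq_complex/= !eqxx.
  have fR r x : f (r%:C *: x) = r%:C * f x.
    rewrite !fE scalerA [_ * r%:C]mulrC -scalerA !gZ.
    by apply/eqP; rewrite eq_complex/=; apply/andP; split; apply/eqP; ring.
  have fi x : f ('i *: x) = 'i * f x.
    rewrite !fE scalerA -expr2 sqr_i scaleN1r gN.
    by apply/eqP; rewrite eq_complex/=; apply/andP; split; apply/eqP; ring.
  move=> a u v; rewrite fD; congr (_ + _).
  rewrite {1}(complexE a) scalerDl fD fR.
  by rewrite -scalerA fi fR {3}(complexE a) scalerDl mulrA.
have fle x : cmod (f x) <= rnorm x.
  apply: cmodC_le; first exact: rnorm_ge0.
  move=> a; rewrite -rnorm_scale; apply: le_trans (gle _).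
  suff -> : complex.Re (a * f x) = g (a *: x) by [].
  have := lf a x 0; rewrite addr0.
  have -> : f 0 = 0.
    have g0 : g 0 = 0 by have := gD 0 0; rewrite addr0; lra.
    by rewrite fE scaler0 g0 oppr0.
  by rewrite addr0 => e; rewrite -[a * f x]/(a *: f x) -e.
have bf : f \in bounded_linear.
  by apply/asboolP; split=> //; exists 1 => x; rewrite mul1r.
exists (BoundedOperator bf).
  by apply: opnorm_le => x; rewrite rnormE_le; apply: le_trans.
rewrite /= fE; suff -> : g ('i *: x0) = 0.
  by rewrite gx0 oppr0.
set b := g ('i *: x0).
have := fle x0; rewrite fE -/b gx0.
rewrite -(ler_sqr) ?nnegrE ?rnorm_ge0 ?cmod_ge0// cmod_sqr/= sqrrN => hb.
apply/eqP; rewrite -sqrf_eq0; apply/eqP/le_anti; rewrite sqr_ge0 andbT.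
move: hb; lra.
Qed.

End HahnBanach.

(** * Bounded operators, rank-one operators and invertibility *)

Section Operators.
Variables (R : realType).
Implicit Types (U V W : normedModType R[i]) (a : R[i]).

Section Evaluation.
Variables (V W : normedModType R[i]).
Implicit Types (f g : 'B(V, W)).

Lemma opD f g x : (f + g) x = f x + g x. Proof. by []. Qed.
Lemma opN f x : (- f) x = - f x. Proof. by []. Qed.
Lemma opZ a f x : (a *: f) x = a *: f x. Proof. by []. Qed.
Lemma op0 x : (0 : 'B(V, W)) x = 0. Proof. by []. Qed.

Lemma dualZ (k : dual V) a x : k (a *: x) = a * (k x : R[i]).
Proof. by rewrite linearZ. Qed.

Lemma rnorm_apply f x : rnorm (f x) <= rnorm f * rnorm x.
Proof. exact: opnormP. Qed.

Lemma rnorm_op_le f (M : R) : 0 <= M ->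
  (forall x, rnorm (f x) <= M * rnorm x) -> rnorm f <= M.
Proof.
move=> M0 fM; apply: opnorm_le => x; rewrite (rnormE_le x 1) => x1.
by rewrite (le_trans (fM x))// ler_piMr.
Qed.

End Evaluation.

Definition compop U V W (S : 'B(V, W)) (T : 'B(U, V)) : 'B(U, W).
Proof.
exists (S \o T); apply/asboolP; split.
  by move=> a u v; rewrite /= !linearP.
exists (rnorm S * rnorm T) => x.
rewrite (le_trans (rnorm_apply S (T x)))// -mulrA.
by rewrite ler_wpM2l ?rnorm_ge0 ?rnorm_apply.
Defined.

Definition idop V : 'B(V).
Proof.
by exists id; apply/asboolP; split=> //; exists 1 => x; rewrite mul1r.
Defined.

Definition tens V W (u : W) (f : dual V) : 'B(V, W).
Proof.
exists (fun x => (f x : R[i]) *: u); apply/asboolP; split.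
  by move=> a x y; rewrite linearP scalerDl scalerA.
exists (rnorm f * rnorm u) => x.
by rewrite rnorm_scale mulrAC ler_wpM2r ?rnorm_ge0 ?rnorm_apply.
Defined.

Lemma compopE U V W (S : 'B(V, W)) (T : 'B(U, V)) x : compop S T x = S (T x).
Proof. by []. Qed.

Lemma idopE V (x : V) : idop V x = x. Proof. by []. Qed.

Lemma tensE V W (u : W) (f : dual V) x : tens u f x = (f x : R[i]) *: u.
Proof. by []. Qed.

Definition inverse_pair V (T S : 'B(V)) := cancel T S /\ cancel S T.
Definition invertible V (T : 'B(V)) := exists S, inverse_pair T S.

Lemma inverse_pair_sym V (T S : 'B(V)) : inverse_pair T S -> inverse_pair S T.
Proof. by case. Qed.

Lemma inverse_pair_comp V (T S T' S' : 'B(V)) : inverse_pair T S ->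
  inverse_pair T' S' -> inverse_pair (compop T T') (compop S' S).
Proof.
move=> [TS ST] [TS' ST']; split=> x; rewrite !compopE; first by rewrite TS TS'.
by rewrite ST' ST.
Qed.

Lemma invertible_comp V (T T' : 'B(V)) : invertible T -> invertible T' ->
  invertible (compop T T').
Proof. by move=> [S i] [S' i']; eexists; exact: inverse_pair_comp i i'. Qed.

Lemma invertible_scalar V (c : R[i]) : c != 0 ->
  inverse_pair (c *: idop V) (c^-1 *: idop V).
Proof.
by move=> c0; split=> x; rewrite !opZ !idopE scalerA ?mulVf ?divff// scale1r.
Qed.

(** The inverse of [1 + u (x) f] is [1 - (1 + f u)^-1 u (x) f]. *)
Lemma invertible_id_tens V (u : V) (f : dual V) : f u != - 1 :> R[i] ->
  invertible (idop V + tens u f).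
Proof.
move=> fu; set c : R[i] := (1 + (f u : R[i]))^-1.
have c1 : (1 + (f u : R[i])) != 0 by rewrite addrC addr_eq0.
exists (idop V - c *: tens u f); split=> x;
  rewrite !(opD, opN, opZ, idopE, tensE) !scalerA.
  rewrite linearD/= dualZ -addrA -[RHS]addr0; congr (_ + _).
  rewrite -scalerBl; set b : R[i] := f x.
  have -> : b - c * (b + b * (f u : R[i])) = b * (1 - c * (1 + (f u : R[i]))).
    by ring.
  by rewrite mulVf// subrr mulr0 scale0r.
rewrite linearB/= dualZ -addrA -[RHS]addr0; congr (_ + _).
rewrite addrC -scalerBl; set b : R[i] := f x.
have -> : b - c * b * (f u : R[i]) - c * b = b * (1 - c * (1 + (f u : R[i]))).
  by ring.
by rewrite mulVf// subrr mulr0 scale0r.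
Qed.

Lemma rnorm_tens V W (u : W) (f : dual V) : rnorm (tens u f) = rnorm u * rnorm f.
Proof.
apply/le_anti/andP; split.
  apply: rnorm_op_le; first by rewrite mulr_ge0 ?rnorm_ge0.
  move=> x; rewrite tensE rnorm_scale mulrC -mulrA.
  by rewrite ler_wpM2l ?rnorm_ge0 ?rnorm_apply.
have [->|u0] := eqVneq u 0; first by rewrite rnorm0 mul0r rnorm_ge0.
have up : 0 < rnorm u by rewrite rnorm_gt0.
rewrite -ler_pdivlMl//; apply: rnorm_op_le.
  by rewrite mulr_ge0 ?invr_ge0 ?rnorm_ge0.
move=> x; rewrite -mulrA ler_pdivlMl// (le_trans _ (rnorm_apply _ _))//.
by rewrite tensE rnorm_scale mulrC.
Qed.

Lemma tens_addl V W (u u' : W) (f : dual V) :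
  tens (u + u') f = tens u f + tens u' f.
Proof. by apply: bounded_operator_eq => x; rewrite opD !tensE scalerDr. Qed.

Lemma tens_addr V W (u : W) (f f' : dual V) :
  tens u (f + f') = tens u f + tens u f'.
Proof. by apply: bounded_operator_eq => x; rewrite opD !tensE scalerDl. Qed.

Lemma tens_scale V W a (u : W) (f : dual V) : tens (a *: u) f = tens u (a *: f).
Proof.
by apply: bounded_operator_eq => x; rewrite !tensE opZ scalerA mulrC.
Qed.

Lemma dual_neq0 V (f : dual V) : f != 0 -> exists x, f x = 1 :> R[i].
Proof.
move=> f0; have [x fx] : exists x, (f x : R[i]) != 0.
  apply: contrapT => h; case/eqP: f0; apply: bounded_operator_eq => x.
  by apply/eqP/negPn/negP => fx; apply: h; exists x.
by exists ((f x : R[i])^-1 *: x); rewrite linearZ/=; exact: mulVf.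
Qed.

Lemma exists_dual1 V (x : V) : x != 0 -> exists f : dual V, f x = 1 :> R[i].
Proof.
move=> x0; have [f _ fx] := norming_functional x.
exists (((rnorm x)%:C)^-1 *: f); rewrite opZ fx.
by apply: mulVf; rewrite fmorph_eq0 rnorm_eq0.
Qed.

Lemma dual_sep V (x : V) : (forall f : dual V, f x = 0) -> x = 0.
Proof.
move=> h; apply/eqP/negPn/negP => /exists_dual1[f].
by rewrite h => /eqP; rewrite eq_sym oner_eq0.
Qed.

(** Invertible operators act transitively on biorthogonal pairs, and the operator
can be kept trivial on whatever is annihilated by both pairs. It is a product
[W1 W2] of two rank-one perturbations of the identity: [W1 = 1 + (u - x) (x) k],
with [k x = 1] and [k u] nonzero, moves [x] to [u]; then [W2], which fixes [x],
corrects the functional. *)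
Lemma transitive_step V (x u : V) (h f : dual V) :
  h x = 1 :> R[i] -> f u = 1 :> R[i] ->
  exists W : 'B(V), [/\ invertible W, W x = u, forall y, f (W y) = h y,
    forall z, h z = 0 -> f z = 0 -> W z = z &
    forall l : dual V, l x = 0 -> l u = 0 -> forall y, l (W y) = l y].
Proof.
move=> hx fu.
have [k [kx ku kz]] : exists k : dual V,
    [/\ k x = 1 :> R[i], (k u : R[i]) != 0 & forall z, h z = 0 -> f z = 0 -> k z = 0].
  have [hu|hu] := eqVneq (h u : R[i]) 0; last by exists h; split.
  have [fx|fx] := eqVneq (f x : R[i]) 0.
    exists (h + f); split; rewrite ?opD ?hx ?fx ?addr0// ?hu ?fu ?add0r ?oner_eq0//.
    by move=> z hz fz; rewrite opD hz fz addr0.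
  exists ((f x : R[i])^-1 *: f); split=> [||z _ fz]; rewrite opZ.
  - exact: mulVf.
  - by rewrite fu; apply: mulf_neq0; rewrite ?oner_eq0 ?invr_eq0.
  - by rewrite fz scaler0.
pose W1 : 'B(V) := idop V + tens (u - x) k.
have W1E y : W1 y = y + (k y : R[i]) *: (u - x) by [].
have W1inv : invertible W1.
  apply: invertible_id_tens; rewrite linearB/= kx.
  by apply: contra ku => /eqP e; apply/eqP; rewrite -[LHS](subrK 1) e addNr.
have W1x : W1 x = u by rewrite W1E kx scale1r addrC subrK.
pose r : dual V := h - compop f W1.
have rE y : r y = h y - f (W1 y) by [].
pose W2 : 'B(V) := idop V + tens x r.
have W2E y : W2 y = y + (r y : R[i]) *: x by [].
have rx : r x = 0 by rewrite rE W1x hx fu subrr.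
have W2inv : invertible W2.
  by apply: invertible_id_tens; rewrite rx eq_sym oppr_eq0 oner_eq0.
clearbody W1 r W2.
exists (compop W1 W2); split.
- exact: invertible_comp.
- by rewrite compopE W2E rx scale0r addr0.
- move=> y; rewrite compopE W2E linearD/= linearZ/= W1x linearD/= linearZ/= fu.
  by rewrite rE [X in _ + X = _]mulr1 addrC subrK.
- move=> z hz fz; rewrite compopE.
  have W1z : W1 z = z by rewrite W1E kz// scale0r addr0.
  by rewrite W2E rE W1z hz fz subrr scale0r addr0.
- move=> l lx lu y; rewrite compopE W1E linearD/= linearZ/= linearB/= lx lu subrr.
  by rewrite scaler0 addr0 W2E linearD/= linearZ/= lx scaler0 addr0.
Qed.

Definition rank_le1 V W (T : 'B(V, W)) := exists u f, T = tens u f.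

(** Choose [x1, x2] and [f1, f2] with [f_i (A x_j)] equal to 0 or 1 according as
[i] and [j] differ or agree. Two applications of [transitive_step] give an
invertible [W] that agrees with [A] at both [x_i], and such that [f_i W = f_i A].
The operator sought is [- W], modified on the line of [x2] so that it takes the
value [- 2 A x2] at [x2]: adding [A] then kills [x1] and [f1], adding it twice
kills [x2] and [f2]. Killing both a vector and a functional makes the sums
neither injective nor surjective, so that both moduli detect them. *)
Lemma rank_ge2_singular_shifts V (A : 'B(V)) : ~ rank_le1 A ->
  exists T, [/\ invertible T,
    exists z (k : dual V),
      [/\ z != 0, k != 0, (T + A) z = 0 & forall y, k ((T + A) y) = 0] &
    exists z (k : dual V),
      [/\ z != 0, k != 0, (T + A + A) z = 0 & forall y, k ((T + A + A) y) = 0]].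
Proof.
move=> rA.
have [x1 Ax1] : exists x, A x != 0.
  apply: contrapT => h; apply: rA; exists 0, 0; apply: bounded_operator_eq => x.
  by rewrite tensE scaler0; apply/eqP/negPn/negP => Ax; apply: h; exists x.
have [f1 f1u] := exists_dual1 Ax1.
have [x2 Ax2 f1Ax2] : exists2 x, A x != 0 & f1 (A x) = 0.
  have [x h] : exists x, A x != tens (A x1) (compop f1 A) x.
    apply: contrapT => h; apply: rA; exists (A x1), (compop f1 A).
    apply: bounded_operator_eq => x.
    by apply/eqP/negPn/negP => Ax; apply: h; exists x.
  exists (x - (f1 (A x) : R[i]) *: x1); rewrite linearB/= linearZ/= ?subr_eq0//.
  by rewrite linearB/= linearZ/= f1u [X in _ - X]mulr1 subrr.
(* Subtracting a multiple of [f1] makes the second functional vanish at [A x1]. *)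
have [f2' f2'u] := exists_dual1 Ax2.
pose f2 : dual V := f2' - (f2' (A x1) : R[i]) *: f1.
have f2u1 : f2 (A x1) = 0.
  by rewrite /f2 opD opN opZ f1u [X in _ - X]mulr1 subrr.
have f2u2 : f2 (A x2) = 1.
  by rewrite /f2 opD opN opZ f1Ax2 scaler0 subr0.
clearbody f2.
pose h1 : dual V := compop f1 A; pose h2 : dual V := compop f2 A.
have [W1 [W1inv W1x W1f _ _]] := transitive_step (h := h1) f1u f1u.
have [S1 [W1K S1K]] := W1inv.
(* The second pair is pulled back by [W1]; the step for it leaves the first alone. *)
pose u2 := S1 (A x2); pose g2 : dual V := compop f2 W1.
have h1x2 : h1 x2 = 0 by [].
have h2x1 : h2 x1 = 0 by [].
have h1u2 : h1 u2 = 0 by rewrite -W1f /u2 S1K.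
have g2x1 : g2 x1 = 0 by rewrite compopE W1x.
have g2u2 : g2 u2 = 1 by rewrite compopE /u2 S1K.
have [W2 [W2inv W2x W2f W2z W2l]] := transitive_step (h := h2) f2u2 g2u2.
pose W : 'B(V) := compop W1 W2.
have Wx1 : W x1 = A x1 by rewrite compopE W2z.
have Wx2 : W x2 = A x2 by rewrite compopE W2x S1K.
have f1W y : f1 (W y) = f1 (A y) by rewrite compopE W1f W2l.
have f2W y : f2 (W y) = f2 (A y) by rewrite compopE; exact: W2f.
have Winv : invertible W by exact: invertible_comp.
clearbody W.
pose D : 'B(V) := - 1 *: idop V + tens (- x2) h2.
have DE y : D y = - y - (h2 y : R[i]) *: x2.
  by rewrite /D opD opZ tensE idopE scaleN1r scalerN.
have Dinv : invertible D.
  have -> : D = compop (- 1 *: idop V) (idop V + tens x2 h2).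
    apply: bounded_operator_eq => y; rewrite DE compopE opZ opD !idopE tensE.
    by rewrite scaleN1r opprD.
  apply: invertible_comp.
    by eexists; apply: invertible_scalar; rewrite oppr_eq0 oner_eq0.
  apply: invertible_id_tens; rewrite compopE f2u2.
  by rewrite -subr_eq0 opprK -[1 + 1]/(2%:R) pnatr_eq0.
clearbody D.
have TE y : compop W D y = - W y - (h2 y : R[i]) *: A x2.
  by rewrite compopE DE linearB linearN linearZ/= Wx2.
have nz x (f : dual V) : f (A x) = 1 :> R[i] -> x != 0 /\ f != 0.
  move=> fx; split; apply/eqP => e; move: fx; rewrite e ?linear0 ?op0 => /eqP;
  by rewrite eq_sym oner_eq0.
exists (compop W D); split; first exact: invertible_comp.
  have [a b] := nz _ _ f1u.
  exists x1, f1; split=> // [|y]; rewrite opD TE.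
    by rewrite h2x1 scale0r subr0 Wx1 addNr.
  by rewrite linearD/= linearB linearN linearZ/= f1W f1Ax2 scaler0 subr0 addNr.
have [a b] := nz _ _ f2u2.
exists x2, f2; split=> // [|y]; rewrite !opD TE.
  by rewrite compopE f2u2 scale1r Wx2 subrK addNr.
rewrite !linearD linearN linearN linearZ/= f2W f2u2 [X in _ - X]mulr1.
by rewrite subrK addNr.
Qed.

End Operators.

(** * Lower bounds and openness, with constants *)

Section Bounds.
Variables (R : realType) (Z : normedModType R[i]).
Implicit Types (T S A : 'B(Z)) (z : Z) (c e : R).

Definition bounded_below c T := forall z, c * rnorm z <= rnorm (T z).
Definition onto c T := forall y, exists2 x, T x = y & c * rnorm x <= rnorm y.

Lemma inverse_pair_bounded_below T S c : inverse_pair T S -> 0 <= c ->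
  c * rnorm S <= 1 -> bounded_below c T.
Proof.
move=> [TS _] c0 cS z; rewrite -{1}(TS z).
rewrite (le_trans (ler_wpM2l c0 (rnorm_apply S (T z))))// mulrA.
by rewrite ler_piMl ?rnorm_ge0.
Qed.

Lemma inverse_pair_onto T S c : inverse_pair T S -> 0 <= c ->
  c * rnorm S <= 1 -> onto c T.
Proof.
move=> [_ ST] c0 cS y; exists (S y); first exact: ST.
rewrite (le_trans (ler_wpM2l c0 (rnorm_apply S y)))// mulrA.
by rewrite ler_piMl ?rnorm_ge0.
Qed.

Lemma inverse_pair_bound T S : inverse_pair T S ->
  exists c, [/\ 0 < c, bounded_below c T & onto c T].
Proof.
move=> iTS; have p : 0 < rnorm S + 1 by rewrite ltr_wpDl ?rnorm_ge0.
have c0 : 0 <= (rnorm S + 1)^-1 by rewrite invr_ge0 ltW.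
have cS : (rnorm S + 1)^-1 * rnorm S <= 1.
  by rewrite ler_pdivrMl// mulr1 lerDl.
exists (rnorm S + 1)^-1; split.
- by rewrite invr_gt0.
- exact: inverse_pair_bounded_below iTS c0 cS.
- exact: inverse_pair_onto iTS c0 cS.
Qed.

Lemma bounded_onto_invertible c d T : 0 < c -> 0 < d -> bounded_below c T ->
  onto d T -> invertible T.
Proof.
move=> c0 d0 bT oT.
have inj x y : T x = T y -> x = y.
  move=> e; apply/eqP; rewrite -subr_eq0 -rnorm_eq0; apply/eqP/le_anti.
  rewrite rnorm_ge0 andbT -(pmulr_rle0 _ c0) (le_trans (bT _))//.
  by rewrite linearB/= e subrr rnorm0.
have [s sP] := choice (fun y => let: ex_intro2 x p q := oT y in
  ex_intro (fun x => T x = y /\ d * rnorm x <= rnorm y) x (conj p q)).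
have sb : s \in bounded_linear.
  apply/asboolP; split=> [a u v|].
    by apply: inj; rewrite linearP/= !(sP _).1.
  by exists d^-1 => x; rewrite ler_pdivlMl// (sP x).2.
exists (BoundedOperator sb); split=> x; last exact: (sP x).1.
by apply: inj; rewrite /= (sP _).1.
Qed.

Lemma bounded_below_perturb c T A : bounded_below c T ->
  bounded_below (c - rnorm A) (T + A).
Proof.
move=> bT z; rewrite opD mulrBl (le_trans _ (rnorm_leB _ _))//.
by rewrite lerB ?bT ?rnorm_apply.
Qed.

End Bounds.

Section Complete.
Variables (R : realType) (Z : completeNormedModType R[i]).
Implicit Types (T S A : 'B(Z)) (z : Z) (c e : R).

Lemma rnorm_cauchy_limit (w : nat -> Z) :
  (forall e, 0 < e -> exists N, forall m n, (N <= m)%N -> (N <= n)%N ->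
    rnorm (w m - w n) <= e) ->
  exists v, forall e, 0 < e -> exists N, forall n, (N <= n)%N ->
    rnorm (w n - v) <= e.
Proof.
move=> cw.
have cv : cvg (w @ \oo).
  apply/cauchy_cvgP/cauchy_exP => eps eps0.
  have [e e0 ee] : exists2 e : R, 0 < e & e%:C = eps.
    exists (complex.Re eps); last by rewrite RRe_real// gtr0_real.
    by rewrite -ltcR RRe_real// gtr0_real.
  have [N hN] := cw (e / 2) (divr_gt0 e0 (ltr0n _ 2)).
  exists (w N), N => // n Nn; rewrite -ball_normE /ball_ /= -ee -rnormE ltcR.
  by rewrite (le_lt_trans (hN N n _ _))//; lra.
exists (lim (w @ \oo)) => e e0.
move/cvgrPdist_le: cv => /(_ e%:C); rewrite ltcR => /(_ e0)[N _ hN].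
exists N => n Nn; rewrite rnormB -rnormE_le; exact: hN.
Qed.

(** The equation [(T + A) x = y] is solved by successive approximation: a preimage
under [T] of the current error is added to the approximate solution. The sum of
[c - rnorm A] times the distance travelled and of the norm of the error never
increases, which gives at once the Cauchy property and the sharp constant. *)
Lemma onto_perturb c T A : rnorm A < c -> onto c T ->
  onto (c - rnorm A) (T + A).
Proof.
move=> Ac oT y; set a := rnorm A in Ac *.
have a0 : 0 <= a by exact: rnorm_ge0.
have c0 : 0 < c by exact: le_lt_trans Ac.
have [s sP] := choice (fun y => let: ex_intro2 x p q := oT y in
  ex_intro (fun x => T x = y /\ c * rnorm x <= rnorm y) x (conj p q)).
(* A pair consists of the approximate solution and of the error left. *)
pose st (p : Z * Z) := (p.1 + s p.2, - A (s p.2)).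
pose p n := iter n st (0, y).
have pS1 n : (p n.+1).1 = (p n).1 + s (p n).2 by [].
have pS2 n : (p n.+1).2 = - A (s (p n).2) by [].
have sol n : (T + A) (p n).1 + (p n).2 = y.
  elim: n => [|n IH]; first by rewrite linear0 add0r.
  rewrite pS1 pS2 linearD -[RHS]IH -addrA; congr (_ + _).
  rewrite -[LHS]/(T (s (p n).2) + A (s (p n).2) - A (s (p n).2)).
  by rewrite (sP _).1 addrK.
have step n : (c - a) * rnorm (s (p n).2) + rnorm (p n.+1).2 <= rnorm (p n).2.
  rewrite pS2 rnormN; have := (sP (p n).2).2.
  by have := rnorm_apply A (s (p n).2); rewrite -/a; lra.
have ca0 : 0 < c - a by rewrite subr_gt0.
have tele n k : (c - a) * rnorm ((p (k + n)%N).1 - (p n).1) +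
    rnorm (p (k + n)%N).2 <= rnorm (p n).2.
  elim: k => [|k IH]; first by rewrite add0n subrr rnorm0 mulr0 add0r.
  apply: le_trans IH; have := step (k + n)%N.
  have : (c - a) * rnorm ((p (k.+1 + n)%N).1 - (p n).1) <=
      (c - a) * (rnorm ((p (k + n)%N).1 - (p n).1) + rnorm (s (p (k + n)%N).2)).
    by rewrite ler_pM2l// addSn pS1 addrAC ler_rnormD.
  rewrite !addSn; lra.
have small n : rnorm (p n).2 <= (a / c) ^+ n * rnorm y.
  elim: n => [|n IH]; first by rewrite expr0 mul1r.
  rewrite exprS -mulrA; apply: le_trans (ler_wpM2l _ IH); last first.
    by rewrite divr_ge0// ltW.
  rewrite pS2 rnormN (le_trans (rnorm_apply A _))// -/a -mulrA ler_wpM2l//.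
  by rewrite ler_pdivlMl// (sP _).2.
have tends e : 0 < e -> exists N, forall n, (N <= n)%N -> rnorm (p n).2 <= e.
  move=> e0.
  have /cvgrPdist_lt/(_ (e / (rnorm y + 1))) :
      (fun n => (a / c) ^+ n) @ \oo --> (0 : R).
    apply: cvg_expr; rewrite ger0_norm; last by rewrite divr_ge0// ltW.
    by rewrite ltr_pdivrMr// mul1r.
  have y1 : 0 < rnorm y + 1 by rewrite ltr_wpDl ?rnorm_ge0.
  rewrite divr_gt0// => /(_ isT)[N _ hN]; exists N => n Nn.
  apply: (le_trans (small n)).
  have := hN n Nn; rewrite /= sub0r normrN ltr_pdivlMr// ger0_norm; last first.
    by rewrite exprn_ge0// divr_ge0// ltW.
  have : 0 <= (a / c) ^+ n by rewrite exprn_ge0// divr_ge0// ltW.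
  lra.
have [v vlim] : exists v, forall e, 0 < e -> exists N, forall n, (N <= n)%N ->
    rnorm ((p n).1 - v) <= e.
  apply: rnorm_cauchy_limit => e e0.
  have [N hN] := tends _ (mulr_gt0 ca0 e0).
  have main m n : (N <= m)%N -> (m <= n)%N -> rnorm ((p n).1 - (p m).1) <= e.
    move=> Nm mn; rewrite -(ler_pM2l ca0); apply: le_trans (hN m Nm).
    have := tele m (n - m)%N; rewrite subnK// => h; apply: le_trans h.
    by rewrite lerDl rnorm_ge0.
  exists N => m n Nm Nn; have [mn|/ltnW nm] := leqP m n; last exact: main.
  by rewrite rnormB main.
exists v.
  apply/eqP; rewrite -subr_eq0 -rnorm_eq0; apply/eqP/le_anti.
  rewrite rnorm_ge0 andbT; apply/ler_addgt0Pl => e e0; rewrite addr0.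
  have b0 : 0 < rnorm (T + A) + 1 by rewrite ltr_wpDl ?rnorm_ge0.
  have [N hN] := vlim _ (divr_gt0 (divr_gt0 e0 (ltr0n _ 2)) b0).
  have [M hM] := tends _ (divr_gt0 e0 (ltr0n _ 2)).
  pose n := maxn N M.
  have /hN : (N <= n)%N by rewrite leq_maxl.
  have /hM : (M <= n)%N by rewrite leq_maxr.
  move=> h1; rewrite ler_pdivlMr// => h2.
  have -> : (T + A) v - y = (T + A) (v - (p n).1) - (p n).2.
    by rewrite linearB -[in LHS](sol n) opprD addrA.
  rewrite (le_trans (ler_rnormD _ _))// rnormN.
  rewrite rnormB in h2.
  have := rnorm_apply (T + A) (v - (p n).1).
  have := rnorm_ge0 (v - (p n).1); lra.
apply/ler_addgt0Pl => e e0.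
have [N hN] := vlim _ (divr_gt0 e0 ca0).
have := hN N (leqnn N); rewrite ler_pdivlMr// rnormB => h.
have := tele 0%N N; rewrite addn0 subr0 => h2.
have := rnorm_ge0 (p N).2.
have := ler_wpM2l (ltW ca0) (ler_rnormD (v - (p N).1) (p N).1).
rewrite subrK; lra.
Qed.

(** So every operator is a difference of two invertible ones. *)
Lemma invertible_shift T :
  exists2 c : R[i], c != 0 & invertible (c *: idop Z + T).
Proof.
set r := rnorm T + 1; have r0 : 0 < r by rewrite ltr_wpDl ?rnorm_ge0.
have rc0 : r%:C != 0 :> R[i] by rewrite fmorph_eq0 gt_eqF.
exists r%:C => //.
have ip := invertible_scalar Z rc0.
have rn : r * rnorm ((r%:C)^-1 *: idop Z) <= 1.
  rewrite rnorm_scale cmodV cmodR ger0_norm ?(ltW r0)// mulrA.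
  rewrite divff ?gt_eqF// mul1r.
  by apply: rnorm_op_le => // x; rewrite mul1r.
have bb := bounded_below_perturb T (inverse_pair_bounded_below ip (ltW r0) rn).
have lt : rnorm T < r by rewrite ltrDl.
have oo := onto_perturb lt (inverse_pair_onto ip (ltW r0) rn).
by apply: (bounded_onto_invertible _ _ bb oo); rewrite subr_gt0.
Qed.

(** An operator that is bounded below has closed range, and its approximate
solutions converge; the limit is also a limit of solutions in [P]. *)
Lemma bounded_below_limit c T u (P : Z -> Prop) : 0 < c -> bounded_below c T ->
  (forall e, 0 < e -> exists2 w, P w & rnorm (T w - u) <= e) ->
  exists2 v, T v = u & forall e, 0 < e -> exists2 w, P w & rnorm (w - v) <= e.
Proof.
move=> c0 bT h.
have inv0 n : 0 < n.+1%:R^-1 :> R by rewrite invr_gt0.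
have [w wP] := choice (fun n => let: ex_intro2 x p q := h _ (inv0 n) in
  ex_intro (fun x => P x /\ rnorm (T x - u) <= n.+1%:R^-1) x (conj p q)).
have arch e : 0 < e ->
    exists N, forall n, (N <= n)%N -> rnorm (T (w n) - u) <= e.
  move=> e0; have [N hN] : exists N, N.+1%:R^-1 < e.
    have [N _ hN] := near_infty_natSinv_lt (PosNum e0).
    by exists N; exact: (hN N (leqnn N)).
  exists N => n Nn; apply: (le_trans (wP n).2); apply: le_trans (ltW hN).
  by rewrite lef_pV2 ?posrE// ler_nat.
have [v vlim] : exists v, forall e, 0 < e -> exists N, forall n, (N <= n)%N ->
    rnorm (w n - v) <= e.
  apply: rnorm_cauchy_limit => e e0.
  have [N hN] := arch _ (divr_gt0 (mulr_gt0 c0 e0) (ltr0n _ 2)).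
  exists N => m n /hN hm /hN hn; rewrite -(ler_pM2l c0).
  apply: (le_trans (bT _)); rewrite linearB/=.
  have := ler_rnormD (T (w m) - u) (u - T (w n)).
  rewrite addrA subrK (rnormB u); lra.
exists v; last first.
  by move=> e /vlim[N hN]; exists (w N); [exact: (wP N).1|exact: hN].
apply/eqP; rewrite -subr_eq0 -rnorm_eq0; apply/eqP/le_anti.
rewrite rnorm_ge0 andbT; apply/ler_addgt0Pl => e e0; rewrite addr0.
have b0 : 0 < rnorm T + 1 by rewrite ltr_wpDl ?rnorm_ge0.
have [N hN] := vlim _ (divr_gt0 (divr_gt0 e0 (ltr0n _ 2)) b0).
have [M hM] := arch _ (divr_gt0 e0 (ltr0n _ 2)).
pose n := maxn N M.
have /hN : (N <= n)%N by rewrite leq_maxl.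
have /hM : (M <= n)%N by rewrite leq_maxr.
move=> h1; rewrite ler_pdivlMr// => h2.
have := rnorm_apply T (v - w n); rewrite linearB/= (rnormB v) => h3.
have := ler_rnormD (T v - T (w n)) (T (w n) - u).
rewrite addrA subrK; have := rnorm_ge0 (w n - v); lra.
Qed.

End Complete.

(** * What the minimum modulus and the surjectivity modulus have in common *)

(** The two moduli are exchanged by passing to adjoints, but the preserver acts on
operators of the space itself; the properties below hold for both and are all
that the proof uses. The hypotheses of [modulus_defect] control both a vector
and a functional, because the minimum modulus is bounded above by means of
vectors and the surjectivity modulus by means of functionals. In
[modulus_invertible], the first family of perturbations gives surjectivity in the
case of the minimum modulus, the second one gives injectivity in the case of the
surjectivity modulus. *)
Record modulus (R : realType) (Z : normedModType R[i]) (mu : 'B(Z) -> R) :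
    Prop := {
  modulus_ge0 : forall T, 0 <= mu T;
  modulus_lip : forall T A : 'B(Z), mu T - rnorm A <= mu (T + A);
  modulus_inverse : forall (T S : 'B(Z)) (c : R), inverse_pair T S -> 0 <= c ->
    c * rnorm S <= 1 -> c <= mu T;
  modulus_defect : forall (A : 'B(Z)) (e : R) (z : Z) (k : dual Z),
    z != 0 -> k != 0 ->
    rnorm (A z) <= e * rnorm z -> rnorm (compop k A) <= e * rnorm k ->
    mu A <= e;
  modulus_rank1 : forall (T : 'B(Z)) (u : Z) (f : dual Z), 0 < mu T ->
    0 < mu (T + tens u f) \/ 0 < mu (T + tens u f + tens u f);
  modulus_invertible : forall T : 'B(Z), 0 < mu T ->
    (forall y, y != 0 -> exists g, mu (T + tens y g) = 0) ->
    (forall g, g != 0 -> exists y, mu (T + tens y g) = 0) -> invertible T }.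

Section MinimumModulus.
Variables (R : realType) (Z : completeNormedModType R[i]).
Hypothesis nz : exists z : Z, z != 0.
Implicit Types (T S A : 'B(Z)) (c e : R).
Local Notation m := (@minimum_modulus R Z).

Lemma minimum_modulus_bounded_below T : bounded_below (m T) T.
Proof.
move=> z; have [->|z0] := eqVneq z 0; first by rewrite rnorm0 mulr0 rnorm_ge0.
have zp : 0 < rnorm z by rewrite rnorm_gt0.
rewrite -ler_pdivlMr//; apply: ge_inf.
  by exists 0 => _ [x _ <-]; exact: rnorm_ge0.
exists ((rnorm z)^-1%:C *: z); first by apply/rnorm_eq; exact: rnorm_normal.
by rewrite linearZ/= rnorm_pscale ?invr_ge0 ?rnorm_ge0// mulrC.
Qed.

Lemma minimum_modulus_ge c T : bounded_below c T -> c <= m T.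
Proof.
move=> bT; apply: lb_le_inf.
  have [z z0] := nz; exists (rnorm (T ((rnorm z)^-1%:C *: z))).
  by eexists; last reflexivity; apply/rnorm_eq; exact: rnorm_normal.
by move=> _ [x /= /rnorm_eq x1 <-]; rewrite -[c]mulr1 -x1.
Qed.

Lemma minimum_modulus_approx T e : m T = 0 -> 0 < e ->
  exists2 z, rnorm z = 1 & rnorm (T z) <= e.
Proof.
move=> mT e0; apply: contrapT => h.
have : e <= m T; last by rewrite mT leNgt e0.
apply: minimum_modulus_ge => z.
have [->|z0] := eqVneq z 0; first by rewrite rnorm0 mulr0 rnorm_ge0.
have zp : 0 < rnorm z by rewrite rnorm_gt0.
rewrite -ler_pdivlMr// leNgt; apply/negP => lt; apply: h.
exists ((rnorm z)^-1%:C *: z); first exact: rnorm_normal.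
by rewrite linearZ/= rnorm_pscale ?invr_ge0 ?rnorm_ge0// mulrC ltW.
Qed.

(** If [z] is a unit vector and [(T + u (x) f) z] is small then [f z] stays away
from 0, and [- z / f z] solves [T w = u], [f w = -1] up to a small error. *)
Lemma minimum_modulus_rank1_solve T u (f : dual Z) :
  0 < m T -> m (T + tens u f) = 0 ->
  exists2 v, T v = u & f v = -1 :> R[i].
Proof.
set d := m T => d0 m0; set U := rnorm u.
have U0 : 0 <= U by exact: rnorm_ge0.
have approx e : 0 < e -> exists2 w, f w = -1 :> R[i] & rnorm (T w - u) <= e.
  move=> e0; pose e' := Num.min (d / 2) (e * d / (2 * U + 1)).
  have p : 0 < 2 * U + 1 by lra.
  have e'0 : 0 < e' by rewrite lt_min !divr_gt0// mulr_gt0.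
  have le1 : e' <= d / 2 by rewrite ge_min lexx.
  have le2 : e' * (2 * U + 1) <= e * d.
    by rewrite -ler_pdivlMr// ge_min lexx orbT.
  have [z z1 zle] := minimum_modulus_approx m0 e'0.
  rewrite opD tensE in zle.
  have := minimum_modulus_bounded_below T z; rewrite z1 mulr1 -/d => dT.
  have fzU : d / 2 <= cmod (f z) * U.
    have := ler_rnormD (T z + (f z : R[i]) *: u) (- ((f z : R[i]) *: u)).
    by rewrite addrK rnormN rnorm_scale -/U; lra.
  have fz0 : (f z : R[i]) != 0.
    by apply/eqP => fz0; move: fzU; rewrite fz0 cmod0 mul0r; lra.
  have fzp : 0 < cmod (f z) by rewrite cmod_gt0.
  exists (- (f z : R[i])^-1 *: z); first by rewrite dualZ mulNr mulVf.
  have -> : T (- (f z : R[i])^-1 *: z) - u =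
      - (f z : R[i])^-1 *: (T z + (f z : R[i]) *: u).
    by rewrite linearZ/= scalerDr scalerA mulNr mulVf// scaleN1r.
  rewrite rnorm_scale (@rnormN _ R[i]^o) cmodV mulrC ler_pdivrMr//.
  apply: (le_trans zle).
  have Up : 0 < U.
    rewrite lt_neqAle U0 andbT eq_sym; apply/eqP => Uz.
    by move: fzU; rewrite Uz mulr0; lra.
  rewrite -(ler_pM2r Up) -mulrA.
  have := ler_wpM2l (ltW e0) fzU; nra.
have [v Tv vlim] :=
  bounded_below_limit d0 (minimum_modulus_bounded_below T) approx.
exists v => //; apply/eqP; rewrite -subr_eq0 opprK -cmod_eq0; apply/eqP/le_anti.
rewrite cmod_ge0 andbT; apply/ler_addgt0Pl => e e0; rewrite addr0.
have fp : 0 < rnorm f + 1 by rewrite ltr_wpDl ?rnorm_ge0.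
have [w fw] := vlim _ (divr_gt0 e0 fp).
rewrite ler_pdivlMr// rnormB => wv.
have -> : (f v : R[i]) + 1 = f (v - w) by rewrite linearB/= fw opprK.
by have := rnorm_apply f (v - w); have := rnorm_ge0 (v - w); lra.
Qed.

Lemma modulus_minimum : modulus m.
Proof.
have ge0 T : 0 <= m T.
  by apply: minimum_modulus_ge => z; rewrite mul0r rnorm_ge0.
split=> //.
- move=> T A; apply: minimum_modulus_ge; apply: bounded_below_perturb.
  exact: minimum_modulus_bounded_below.
- move=> T S c TS c0 cS; apply: minimum_modulus_ge.
  exact: inverse_pair_bounded_below TS c0 cS.
- move=> A e z k z0 _ Az _; have zp : 0 < rnorm z by rewrite rnorm_gt0.
  rewrite -(ler_pM2r zp); apply: le_trans Az.
  exact: minimum_modulus_bounded_below.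
- move=> T u f T0; apply: contrapT => /not_orP[h1 h2].
  have z A : ~ (0 < m A) -> m A = 0.
    by move=> h; apply/le_anti; rewrite ge0 andbT leNgt; apply/negP.
  have [v Tv fv] := minimum_modulus_rank1_solve T0 (z _ h1).
  move/z: h2; rewrite -addrA -tens_addl => h2.
  have [v' Tv' fv'] := minimum_modulus_rank1_solve T0 h2.
  (* [T v = u] and [T v' = 2 u] force [v' = 2 v], but [f v = f v' = -1]. *)
  have e : v' - (v + v) = 0.
    apply/eqP; rewrite -rnorm_eq0; apply/eqP/le_anti; rewrite rnorm_ge0 andbT.
    rewrite -(pmulr_rle0 _ T0) (le_trans (minimum_modulus_bounded_below T _))//.
    by rewrite linearB linearD/= Tv Tv' subrr rnorm0.
  have := congr1 f e; rewrite linearB linearD/= fv fv' linear0 opprD !opprK.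
  by rewrite addKr => /eqP; rewrite oner_eq0.
- move=> T T0 hy _; apply: (bounded_onto_invertible T0 T0).
    exact: minimum_modulus_bounded_below.
  move=> y; have [->|y0] := eqVneq y 0.
    by exists 0; rewrite ?linear0// !rnorm0 mulr0.
  have [g /(minimum_modulus_rank1_solve T0)[v Tv _]] := hy y y0.
  by exists v => //; rewrite -Tv; exact: minimum_modulus_bounded_below.
Qed.

End MinimumModulus.

Section SurjectivityModulus.
Variables (R : realType) (Z : completeNormedModType R[i]).
Hypothesis nz : exists z : Z, z != 0.
Implicit Types (T S A : 'B(Z)) (c e : R).
Local Notation q := (@surjectivity_modulus R Z).
Local Notation qset T := [set e : R | 0 <= e /\
    [set e%:C *: z | z in @unit_ball R Z] `<=` T @` @unit_ball R Z].

Let qset0 T : qset T 0.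
Proof.
split=> // _ [z _ <-]; exists 0; first by rewrite /unit_ball /= normr0.
by rewrite linear0 scale0r.
Qed.

Let qset_dual T e (k : dual Z) : qset T e -> e * rnorm k <= rnorm (compop k T).
Proof.
move=> [e0 eT]; have [->|en0] := eqVneq e 0; first by rewrite mul0r rnorm_ge0.
have ep : 0 < e by rewrite lt_neqAle eq_sym en0.
rewrite -ler_pdivlMl//; apply: opnorm_le => x x1.
have [|w w1 Tw] := eT (e%:C *: x); first by exists x.
rewrite ler_pdivlMl//.
have -> : e * cmod (k x) = cmod (compop k T w).
  by rewrite compopE Tw dualZ cmodM cmodR ger0_norm.
exact: opnorm_ub.
Qed.

Let qset_sup T : has_sup (qset T).
Proof.
split; first by exists 0; exact: qset0.
have [z z0] := nz; have [k kz] := exists_dual1 z0.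
have kp : 0 < rnorm k.
  rewrite rnorm_gt0; apply/eqP => k0.
  by move/eqP: kz; rewrite k0 op0 eq_sym oner_eq0.
exists (rnorm (compop k T) / rnorm k) => e eT.
by rewrite ler_pdivlMr//; exact: qset_dual.
Qed.

Lemma surjectivity_modulus_ge0 T : 0 <= q T.
Proof. by apply: (ub_le_sup (qset_sup T).2). Qed.

Lemma surjectivity_modulus_dual T (k : dual Z) :
  q T * rnorm k <= rnorm (compop k T).
Proof.
have [->|k0] := eqVneq k 0; first by rewrite rnorm0 mulr0 rnorm_ge0.
have kp : 0 < rnorm k by rewrite rnorm_gt0.
rewrite -ler_pdivlMr//; apply: ge_sup; first exact: (qset_sup T).1.
by move=> e eT; rewrite ler_pdivlMr//; exact: qset_dual.
Qed.

Lemma surjectivity_modulus_onto c T : 0 <= c -> c < q T -> onto c T.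
Proof.
move=> c0 cq y; have [->|y0] := eqVneq y 0.
  by exists 0; rewrite ?linear0// !rnorm0 mulr0.
have yp : 0 < rnorm y by rewrite rnorm_gt0.
have [e [e0 eT] ce] : exists2 e, qset T e & c < e.
  have qc : 0 < q T - c by rewrite subr_gt0.
  have [e eT] := sup_adherent qc (qset_sup T).
  by rewrite opprB addrC subrK => ce; exists e.
have ep : 0 < e by exact: le_lt_trans ce.
have [|x x1 Tx] := eT (e%:C *: ((rnorm y)^-1%:C *: y)).
  exists ((rnorm y)^-1%:C *: y) => //.
  by rewrite /unit_ball/= (rnormE_le _ 1) rnorm_normal.
exists ((rnorm y / e)%:C *: x).
  rewrite linearZ/= Tx !scalerA -!rmorphM/=.
  by rewrite mulrA divfK ?gt_eqF// divff ?gt_eqF// scale1r.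
rewrite rnorm_pscale; last by rewrite divr_ge0// ltW.
move: x1; rewrite /unit_ball/= (rnormE_le _ 1) => x1.
rewrite mulrA mulrCA -mulrA ler_piMr ?(ltW yp)//.
rewrite mulrAC ler_pdivrMr// mul1r.
by rewrite (le_trans _ (ltW ce))// ler_piMr.
Qed.

Lemma surjectivity_modulus_ge c T : 0 <= c -> onto c T -> c <= q T.
Proof.
move=> c0 oT; apply: (ub_le_sup (qset_sup T).2); split=> // _ [z z1 <-].
have [->|cn0] := eqVneq c 0; first by apply: (qset0 T).2; exists z.
have cp : 0 < c by rewrite lt_neqAle eq_sym cn0.
have [x Tx cx] := oT (c%:C *: z); exists x => //.
move: z1 cx; rewrite /unit_ball/= !(rnormE_le _ 1) => z1.
rewrite rnorm_pscale// ler_pM2l// => /le_trans; exact.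
Qed.

Lemma surjectivity_modulus_comp T A :
  0 < q T -> invertible A -> 0 < q (compop T A).
Proof.
move=> T0 [S AS]; have [d [d0 _ dA]] := inverse_pair_bound AS.
have c0 : 0 < q T / 2 by rewrite divr_gt0.
have cT : onto (q T / 2) T by apply: surjectivity_modulus_onto; lra.
apply: lt_le_trans (mulr_gt0 d0 c0) (surjectivity_modulus_ge _ _).
  exact: ltW (mulr_gt0 d0 c0).
move=> y; have [x Tx cx] := cT y; have [w Aw dw] := dA x.
exists w; first by rewrite compopE Aw.
apply: le_trans cx; rewrite (_ : _ * _ = q T / 2 * (d * rnorm w)); last by ring.
by rewrite ler_pM2l.
Qed.

(** If [T v = u] then [T + u (x) f = T (1 + v (x) f)]. *)
Lemma surjectivity_modulus_rank1 T v u (f : dual Z) : 0 < q T -> T v = u ->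
  f v != -1 :> R[i] -> 0 < q (T + tens u f).
Proof.
move=> T0 <- fv.
have -> : T + tens (T v) f = compop T (idop Z + tens v f).
  by apply: bounded_operator_eq => x; rewrite opD compopE linearD/= linearZ.
by apply: surjectivity_modulus_comp => //; exact: invertible_id_tens.
Qed.

Lemma modulus_surjectivity : modulus q.
Proof.
split.
- exact: surjectivity_modulus_ge0.
- move=> T A; rewrite leNgt; apply/negP => lt.
  have h := surjectivity_modulus_ge0 (T + A); have hA := rnorm_ge0 A.
  pose c := (q T + (q (T + A) + rnorm A)) / 2.
  have c0 : 0 <= c by rewrite /c; lra.
  have cq : c < q T by rewrite /c; lra.
  have Ac : rnorm A < c by rewrite /c; lra.
  have := surjectivity_modulus_ge _
    (onto_perturb Ac (surjectivity_modulus_onto c0 cq)).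
  by rewrite subr_ge0 => /(_ (ltW Ac)); rewrite /c; lra.
- move=> T S c TS c0 cS; apply: surjectivity_modulus_ge => //.
  exact: inverse_pair_onto TS c0 cS.
- move=> A e z k _ k0 _ kA; have kp : 0 < rnorm k by rewrite rnorm_gt0.
  rewrite -(ler_pM2r kp); apply: le_trans kA.
  exact: surjectivity_modulus_dual.
- move=> T u f T0.
  have [v Tv _] : exists2 v, T v = u & 0 * rnorm v <= rnorm u.
    exact: surjectivity_modulus_onto.
  have [fv|fv] := eqVneq (f v : R[i]) (- 1).
    right; rewrite -addrA -tens_addl.
    apply: (@surjectivity_modulus_rank1 _ (v + v)) => //.
      by rewrite linearD/= Tv.
    by rewrite linearD/= fv -subr_eq0 opprK subrK oppr_eq0 oner_eq0.
  by left; exact: surjectivity_modulus_rank1 fv.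
- move=> T T0 _ hg; have c0 : 0 < q T / 2 by rewrite divr_gt0.
  have cT : onto (q T / 2) T by apply: surjectivity_modulus_onto; lra.
  (* A vector [v] of the kernel may be added to any preimage [w] of [y], and all
     preimages take the value -1 under [g]; so every [g] vanishes at [v]. *)
  have ker v : T v = 0 -> v = 0.
    move=> Tv; apply: dual_sep => g.
    have [->//|g0] := eqVneq g 0.
    have [y qy] := hg g g0; have [w Tw _] := cT y.
    have g1 x : T x = y -> g x = - 1 :> R[i].
      move=> Tx; apply/eqP/negPn/negP => gx.
      by have := surjectivity_modulus_rank1 T0 Tx gx; rewrite qy ltxx.
    have := g1 (w + v); rewrite !linearD/= Tw Tv addr0 (g1 w Tw) => /(_ erefl).
    by move/(canRL (addKr _)); rewrite addNr.
  apply: (bounded_onto_invertible c0 c0) => // z.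
  have [x Tx cx] := cT (T z).
  have /eqP : x - z = 0 by apply: ker; rewrite linearB/= Tx subrr.
  by rewrite subr_eq0 => /eqP <-; rewrite Tx.
Qed.

End SurjectivityModulus.

Section ModulusTheory.
Variables (R : realType) (Z : normedModType R[i]) (mu : 'B(Z) -> R).
Hypothesis muP : modulus mu.
Implicit Types (T S A : 'B(Z)) (c e : R).

Lemma modulus_invertible_gt0 T : invertible T -> 0 < mu T.
Proof.
move=> [S TS]; have p : 0 < rnorm S + 1 by rewrite ltr_wpDl ?rnorm_ge0.
have ip : 0 < (rnorm S + 1)^-1 by rewrite invr_gt0.
apply: lt_le_trans ip (modulus_inverse muP TS (ltW ip) _).
by rewrite ler_pdivrMl// mulr1 lerDl.
Qed.

Lemma modulus_null A (z : Z) (k : dual Z) : z != 0 -> k != 0 ->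
  A z = 0 -> (forall y, k (A y) = 0) -> mu A = 0.
Proof.
move=> z0 k0 Az kA; apply/le_anti; rewrite modulus_ge0// andbT.
apply: (modulus_defect muP z0 k0); first by rewrite Az rnorm0 mul0r.
have -> : compop k A = 0 by apply: bounded_operator_eq => y; exact: kA.
by rewrite rnorm0 mul0r.
Qed.

Lemma modulus_rank1_eq0 T S x (f : dual Z) : inverse_pair T S ->
  mu (T + tens x f) = 0 <-> f (S x) = -1 :> R[i].
Proof.
move=> TS; split=> [h|fSx].
  apply/eqP/negPn/negP => fSx; suff : 0 < mu (T + tens x f) by rewrite h ltxx.
  have -> : T + tens x f = compop T (idop Z + tens (S x) f).
    apply: bounded_operator_eq => y.
    by rewrite opD compopE linearD/= linearZ/= TS.2.
  apply: modulus_invertible_gt0; apply: invertible_comp; first by exists S.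
  exact: invertible_id_tens.
have m1 : (- 1 : R[i]) == 0 = false by rewrite oppr_eq0 oner_eq0.
apply: (@modulus_null _ (S x) (compop f S)).
- by apply/eqP => e; move/eqP: fSx; rewrite e linear0 eq_sym m1.
- apply/eqP => e; have := congr1 (fun k : dual Z => k x) e.
  by rewrite compopE fSx => /eqP; rewrite m1.
- by rewrite opD tensE TS.2 fSx scaleN1r subrr.
- move=> y; rewrite compopE opD tensE linearD/= linearZ/= TS.1.
  rewrite linearD/= linearZ/= fSx.
  by rewrite [X in _ + X]mulrN1 subrr.
Qed.

Lemma modulus_rank2 A : ~ rank_le1 A ->
  exists T, [/\ 0 < mu T, mu (T + A) = 0 & mu (T + A + A) = 0].
Proof.
move=> /rank_ge2_singular_shifts[T [Tinv [z [k [z0 k0 Az kA]]]]].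
move=> [z' [k' [z0' k0' Az' kA']]].
exists T; split; first exact: modulus_invertible_gt0.
  exact: modulus_null z0 k0 Az kA.
exact: modulus_null z0' k0' Az' kA'.
Qed.

Lemma exists_almost_norming A e : 0 < e -> A != 0 ->
  exists x, [/\ rnorm x = 1, rnorm A - e <= rnorm (A x) & A x != 0].
Proof.
move=> e0 A0; pose e' := Num.min e (rnorm A / 2).
have A1 : 0 < rnorm A by rewrite rnorm_gt0.
have e'0 : 0 < e' by rewrite lt_min e0 divr_gt0.
have le1 : e' <= e by rewrite ge_min lexx.
have le2 : e' <= rnorm A / 2 by rewrite ge_min lexx orbT.
have [_ [x x1 <-] lt] := sup_adherent e'0 (opnorm_has_sup A).
have lt' : rnorm A - e' < rnorm (A x) by exact: lt.
have Ax0 : A x != 0 by rewrite -rnorm_gt0; lra.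
have x0 : x != 0 by apply: contra Ax0 => /eqP->; rewrite linear0.
have xp : 0 < rnorm x by rewrite rnorm_gt0.
move: x1; rewrite /= (rnormE_le x 1) => x1.
have E : rnorm (A ((rnorm x)^-1%:C *: x)) = rnorm (A x) / rnorm x.
  by rewrite linearZ/= rnorm_pscale ?invr_ge0 ?rnorm_ge0// mulrC.
have le3 : rnorm (A x) <= rnorm (A x) / rnorm x.
  by rewrite ler_pdivlMr// ler_piMr// rnorm_ge0.
exists ((rnorm x)^-1%:C *: x); split.
- exact: rnorm_normal.
- rewrite E; lra.
- by rewrite -rnorm_gt0 E; lra.
Qed.

(** Together with [modulus_lip], this expresses the norm of [A] through the additive
structure and the modulus: it is the supremum of [mu T - mu (T + A)]. Let [x] be a
unit vector that almost attains the norm, [u = A x], [a = rnorm u], and let [g]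
be a functional of norm 1 norming [u]. The operator [- a^-1 x (x) g] has norm
[a^-1] and sends [u] to [- x]; the small multiple [eta] of the identity added to
it makes it an invertible operator [S], and [T = S^-1] has modulus almost [a].
Up to terms of order [eta], [T + A] kills the vector [S u] and the functional
[g A S]. *)
Lemma modulus_norming A e : 0 < e -> exists T, rnorm A - e <= mu T - mu (T + A).
Proof.
move=> e0; have [->|A0] := eqVneq A 0.
  by exists 0; rewrite rnorm0 addr0; lra.
have N0 : 0 < rnorm A by rewrite rnorm_gt0.
set N := rnorm A in N0 *.
have e4 : 0 < e / 4 by rewrite divr_gt0.
have [x [x1 xA Ax0]] := exists_almost_norming e4 A0; rewrite -/N in xA.
set u := A x in xA Ax0; set a := rnorm u in xA.
have a0 : 0 < a by rewrite rnorm_gt0.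
have aN : a <= N.
  by rewrite (le_trans (rnorm_apply A x))// x1 mulr1.
have [g g1 gu] := norming_functional u; rewrite -/a in gu.
pose h : dual Z := compop g A.
have hx : h x = a%:C by exact: gu.
have hN : rnorm h <= N.
  apply: rnorm_op_le => [|y]; first exact: ltW.
  rewrite compopE (le_trans (rnorm_apply g _))//.
  by rewrite (le_trans (ler_wpM2r (rnorm_ge0 _) g1))// mul1r rnorm_apply.
have hE y : h y = g (A y) by [].
clearbody h.
pose b := Num.min (1 / (2 * N)) (e / (4 * N ^+ 2)).
have N2 : 0 < N ^+ 2 by rewrite exprn_gt0.
have b0 : 0 < b by rewrite lt_min !divr_gt0 ?mulr_gt0.
(* [S] is invertible unless [g x = a eta], which excludes only one value. *)
have [eta [eta0 etab ga]] : exists eta : R,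
    [/\ 0 < eta, eta <= b & (g x : R[i]) != (a * eta)%:C].
  have [ga|ga] := eqVneq (g x : R[i]) (a * b)%:C; last by exists b.
  exists (b / 2); split; [by rewrite divr_gt0|lra|rewrite ga].
  rewrite (inj_eq (@complexI R)); apply/eqP => /(mulfI (lt0r_neq0 a0)) /eqP.
  by rewrite -subr_eq0 gt_eqF//; lra.
have etaN : eta * N <= 1 / 2.
  apply: le_trans (ler_wpM2r (ltW N0) etab) _.
  rewrite (_ : 1 / 2 = 1 / (2 * N) * N); last by field; rewrite gt_eqF.
  by rewrite ler_pM2r// ge_min lexx.
have etaN2 : eta * N ^+ 2 <= e / 4.
  apply: le_trans (ler_wpM2r (ltW N2) etab) _.
  rewrite (_ : e / 4 = e / (4 * N ^+ 2) * N ^+ 2); last by field; rewrite gt_eqF.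
  by rewrite ler_pM2r// ge_min lexx orbT.
pose S : 'B(Z) := eta%:C *: idop Z - tens x ((a^-1)%:C *: g).
have SE y : S y = eta%:C *: y - ((a^-1)%:C * (g y : R[i])) *: x by [].
have [T [ST TS]] : invertible S.
  have e1 : eta%:C != 0 :> R[i] by rewrite fmorph_eq0 gt_eqF.
  have -> : S = compop (eta%:C *: idop Z)
      (idop Z + tens (- (eta%:C)^-1 *: x) ((a^-1)%:C *: g)).
    apply: bounded_operator_eq => y; rewrite SE compopE !(opZ, opD, idopE, tensE).
    rewrite scalerDr !scalerA; congr (_ + _); rewrite -scaleNr; congr (_ *: _).
    by rewrite mulrAC mulrN mulfV// mulN1r.
  apply: invertible_comp; first by eexists; exact: invertible_scalar.
  apply: invertible_id_tens; rewrite opZ dualZ.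
  apply: contra ga => /eqP E; apply/eqP.
  have a1 : a%:C != 0 :> R[i] by rewrite fmorph_eq0 gt_eqF.
  rewrite rmorphM/=; move: E; rewrite fmorphV; set t := (g x : R[i]) => E.
  have : a%:C * eta%:C * ((a%:C)^-1 * (- (eta%:C)^-1 * t)) = - (a%:C * eta%:C).
    by rewrite [(_)^-1 * _]E mulrN1.
  by rewrite (_ : _ * _ = - t); [move/oppr_inj|field; rewrite a1 e1].
exists T.
have cS : a - e / 4 <= mu T.
  have [neg|pos] := leP (a - e / 4) 0.
    exact: le_trans neg (modulus_ge0 muP T).
  apply: (modulus_inverse muP (conj TS ST) (ltW pos)).
  have : rnorm S <= eta + a^-1.
    apply: (le_trans (ler_rnormD _ _)); rewrite rnormN rnorm_tens.
    rewrite !rnorm_pscale ?invr_ge0 ?(ltW a0) ?(ltW eta0)// x1 mul1r; apply: lerD.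
      rewrite ler_piMr ?(ltW eta0)//.
      by apply: rnorm_op_le => // y; rewrite mul1r.
    by rewrite ler_piMr ?invr_ge0 ?(ltW a0).
  move=> /(ler_wpM2l (ltW pos)) /le_trans; apply.
  rewrite [leLHS](_ : _ = 1 + (a * eta - e / 4 * eta - e / 4 / a)); last first.
    by field; rewrite gt_eqF.
  rewrite gerDl.
  have : a * eta <= e / 4 / a.
    rewrite ler_pdivlMr// mulrAC; apply: le_trans etaN2; rewrite mulrC.
    by rewrite ler_pM2l// expr2 ler_pM// ltW.
  have : 0 <= e / 4 * eta by rewrite mulr_ge0// ltW.
  lra.
have dS : mu (T + A) <= e / 2.
  pose z := S u; pose k : dual Z := compop h S.
  have zE : z = eta%:C *: u - x.
    by rewrite /z SE gu -rmorphM/= mulVf ?gt_eqF// scale1r.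
  have kE y : k y = eta%:C * (h y : R[i]) - (g y : R[i]) :> R[i].
    rewrite compopE SE linearB/= !linearZ/= hx.
    rewrite -[LHS]/(_ * _ + _ * _) mulrN; congr (_ - _).
    by rewrite mulrAC -rmorphM/= mulVf ?gt_eqF// mul1r.
  have kT y : k (T y) = h y by rewrite compopE TS.
  clearbody k.
  have zlow : 1 / 2 <= rnorm z.
    have := rnorm_leB x (- (eta%:C *: u)); rewrite rnormN rnorm_scale cmodR.
    rewrite ger0_norm ?(ltW eta0)// x1 -/a rnormB -zE.
    have : eta * a <= eta * N by rewrite ler_pM2l.
    lra.
  have klow : 1 / 2 <= rnorm k.
    rewrite -(ler_pM2r a0); apply: le_trans (rnorm_apply k u).
    have -> : k u = - ((g u : R[i]) - eta%:C * (h u : R[i])) by rewrite kE opprB.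
    rewrite (@rnormN _ R[i]^o).
    have := @rnorm_leB _ R[i]^o (g u) (- (eta%:C * (h u : R[i]))).
    rewrite (@rnormN _ R[i]^o) gu cmodM !cmodR !ger0_norm ?(ltW eta0) ?(ltW a0)//.
    have := ler_wpM2l (ltW eta0) (rnorm_apply h u); rewrite -/a.
    have := ler_wpM2l (ltW eta0) (ler_wpM2r (ltW a0) hN).
    have := ler_wpM2r (ltW a0) etaN.
    lra.
  have gt0 (V' : normedModType R[i]) (y : V') : 1 / 2 <= rnorm y -> y != 0.
    by move=> h'; rewrite -rnorm_gt0; lra.
  apply: (modulus_defect muP (gt0 _ _ zlow) (gt0 _ _ klow)).
    have -> : (T + A) z = eta%:C *: A u.
      rewrite opD [T z]ST zE linearB/= linearZ/= -/u addrCA.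
      by rewrite subrr addr0.
    rewrite rnorm_pscale ?(ltW eta0)//.
    have := ler_wpM2l (ltW eta0) (rnorm_apply A u); rewrite -/N -/a.
    have := ler_wpM2l (ltW eta0) (ler_wpM2l (ltW N0) aN); rewrite -expr2.
    have := ler_wpM2l (ltW e0) zlow; lra.
  have -> : compop k (T + A) = eta%:C *: compop h A.
    apply: bounded_operator_eq => y; rewrite opZ !compopE opD linearD/= kT kE -hE.
    by rewrite addrCA subrr addr0.
  rewrite rnorm_pscale ?(ltW eta0)//.
  have hA : rnorm (compop h A) <= N ^+ 2.
    apply: rnorm_op_le => [|y]; first exact: ltW.
    rewrite compopE (le_trans (rnorm_apply h _))// expr2 -mulrA.
    by rewrite ler_pM ?rnorm_ge0 ?rnorm_apply.
  have := ler_wpM2l (ltW eta0) hA.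
  have := ler_wpM2l (ltW e0) klow; lra.
lra.
Qed.


End ModulusTheory.

(** * Additive families of operators of rank at most one *)

Section RankOneGeometry.
Variable (R : realType).
Implicit Types (V W : normedModType R[i]).

Lemma infinite_dimensional_off_line V : infinite_dimensional V ->
  forall w : V, exists y, ~ exists c : R[i], y = c *: w.
Proof.
move=> Vinf w; apply: contrapT => h; apply: Vinf.
exists 1%N, (fun=> w) => z.
have [c zc] : exists c : R[i], z = c *: w.
  by apply: contrapT => hz; apply: h; exists z.
by exists (fun=> c); rewrite big_ord1.
Qed.

Lemma rank_le1_tens V W (u : W) (f : dual V) : rank_le1 (tens u f).
Proof. by exists u, f. Qed.

Lemma tens_eq0 V W (u : W) (f : dual V) : tens u f = 0 -> u = 0 \/ f = 0.
Proof.
move=> e; have := rnorm_tens u f; rewrite e rnorm0 => /eqP.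
by rewrite eq_sym mulf_eq0 !rnorm_eq0 => /orP[/eqP|/eqP]; [left|right].
Qed.

Lemma tens_injl V W (u u' : W) (f : dual V) :
  f != 0 -> tens u f = tens u' f -> u = u'.
Proof.
move=> /dual_neq0[x fx] /(congr1 (fun T : 'B(V, W) => T x)).
by rewrite !tensE fx !scale1r.
Qed.

Lemma tens_oppl V W (u : W) (f : dual V) : tens (- u) f = - tens u f.
Proof. by apply: bounded_operator_eq => x; rewrite opN !tensE scalerN. Qed.

Lemma tens_oppr V W (u : W) (f : dual V) : tens u (- f) = - tens u f.
Proof. by apply: bounded_operator_eq => x; rewrite opN !tensE scaleNr. Qed.

Lemma tens_injr V W (u : W) (f f' : dual V) :
  u != 0 -> tens u f = tens u f' -> f = f'.
Proof.
move=> u0 e; apply/eqP; rewrite -subr_eq0; apply/eqP.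
have : tens u (f - f') = 0.
  by rewrite tens_addr tens_oppr e subrr.
by case/tens_eq0 => // e0; rewrite e0 eqxx in u0.
Qed.

Lemma tens_proportional V W (u u' : W) (f f' : dual V) : f != 0 ->
  tens u f = tens u' f' -> exists c : R[i], u = c *: u'.
Proof.
move=> /dual_neq0[x fx] /(congr1 (fun T : 'B(V, W) => T x)).
by rewrite !tensE fx scale1r => ->; exists (f' x).
Qed.

Lemma tens_add_rank_le1 V W (u u' : W) (f f' : dual V) : u != 0 -> f != 0 ->
  rank_le1 (tens u f + tens u' f') ->
  (exists c : R[i], u' = c *: u) \/ (exists c : R[i], f' = c *: f).
Proof.
move=> u0 f0 [w [k e]].
have E x : (f x : R[i]) *: u + (f' x : R[i]) *: u' = (k x : R[i]) *: w.
  by have := congr1 (fun T : 'B(V, W) => T x) e; rewrite opD !tensE.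
apply: contrapT => /not_orP[hu hf].
have [a fa] := dual_neq0 f0.
have [b fb f'b] : exists2 b, f b = 0 & f' b = 1 :> R[i].
  have [x h] : exists x, (f' x : R[i]) != (f' a : R[i]) * (f x : R[i]).
    apply: contrapT => h; apply: hf; exists (f' a).
    apply: bounded_operator_eq => x.
    have E' : (f' x : R[i]) = (f' a : R[i]) * (f x : R[i]).
      by apply/eqP/negPn/negP => hx; apply: h; exists x.
    by rewrite opZ.
  pose z := x - (f x : R[i]) *: a; pose d : R[i] := f' z.
  have d0 : d != 0.
    by rewrite /d linearB/= dualZ subr_eq0 mulrC.
  exists (d^-1 *: z); rewrite dualZ; last by rewrite mulVf.
  by rewrite /z linearB/= dualZ fa mulr1 subrr mulr0.
pose a' := a - (f' a : R[i]) *: b.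
have Ea := E a'; have Eb := E b.
rewrite fb f'b scale0r scale1r add0r in Eb.
have e1 : f a' = 1 by rewrite /a' linearB/= dualZ fa fb mulr0 subr0.
have e2 : f' a' = 0 by rewrite /a' linearB/= dualZ f'b mulr1 subrr.
rewrite e1 e2 scale0r scale1r addr0 in Ea.
have ka : (k a' : R[i]) != 0.
  by apply/eqP => ka; move/eqP: u0; rewrite Ea ka scale0r.
apply: hu; exists ((k b : R[i]) / (k a' : R[i])).
by rewrite Eb Ea scalerA divfK.
Qed.

(** The image is the line of [y], unless [T] is zero; similarly for the kernel. *)
Definition has_image V (y : V) (T : 'B(V)) := exists g, T = tens y g.
Definition has_kernel V (g : dual V) (T : 'B(V)) := exists y, T = tens y g.

Lemma has_imageD V (y : V) T T' :
  has_image y T -> has_image y T' -> has_image y (T + T').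
Proof. by move=> [g ->] [g' ->]; exists (g + g'); rewrite tens_addr. Qed.

Lemma has_imageB V (y : V) T T' :
  has_image y T -> has_image y T' -> has_image y (T - T').
Proof.
move=> [g ->] [g' ->]; exists (g - g').
by rewrite tens_addr tens_oppr.
Qed.

Lemma has_kernelD V (g : dual V) T T' :
  has_kernel g T -> has_kernel g T' -> has_kernel g (T + T').
Proof. by move=> [y ->] [y' ->]; exists (y + y'); rewrite tens_addl. Qed.

Lemma has_kernelB V (g : dual V) T T' :
  has_kernel g T -> has_kernel g T' -> has_kernel g (T - T').
Proof.
move=> [y ->] [y' ->]; exists (y - y').
by rewrite tens_addl tens_oppl.
Qed.

Lemma has_image_rank_le1 V (y : V) T : has_image y T -> rank_le1 T.
Proof. by move=> [g ->]; exact: rank_le1_tens. Qed.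

Lemma has_kernel_rank_le1 V (g : dual V) T : has_kernel g T -> rank_le1 T.
Proof. by move=> [y ->]; exact: rank_le1_tens. Qed.

(** Each member of the family shares its image or its kernel with [tens y0 g0], since
their sum has rank at most one. The members of the first kind and those of the
second form subgroups, and a group is not the union of two proper subgroups. *)
Lemma additive_rank_le1_family (F : zmodType) V (psi : F -> 'B(V)) f0 y0 g0 :
  {morph psi : f f' / f + f'} -> (forall f, rank_le1 (psi f)) ->
  y0 != 0 -> g0 != 0 -> psi f0 = tens y0 g0 ->
  (forall f, has_image y0 (psi f)) \/ (forall f, has_kernel g0 (psi f)).
Proof.
move=> psiD rpsi y00 g00 psi0.
have alt f : has_image y0 (psi f) \/ has_kernel g0 (psi f).
  have [y [g e]] := rpsi f.
  have := rpsi (f0 + f); rewrite psiD psi0 e.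
  move=> /(tens_add_rank_le1 y00 g00)[[c yc]|[c gc]].
    by left; exists (c *: g); rewrite yc tens_scale.
  by right; exists (c *: y); rewrite gc tens_scale.
apply: contrapT => /not_orP[/existsNP[f1 h1] /existsNP[f2 h2]].
have k1 : has_kernel g0 (psi f1) by case: (alt f1).
have k2 : has_image y0 (psi f2) by case: (alt f2).
case: (alt (f1 + f2)); rewrite psiD => h.
  by apply: h1; rewrite -[psi f1](addrK (psi f2)); exact: has_imageB.
by apply: h2; rewrite -[psi f2](addKr (psi f1)) addrC; exact: has_kernelB.
Qed.

(** Comparing [A (x + x')] with [A x + A x'] shows that the ratio is the same at [x]
and at [x'] when [B x] and [B x'] are independent; two dependent values are
compared through a third one. *)
Lemma locally_scalar_additive (G : zmodType) V (A B : G -> V) :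
  {morph A : x y / x + y} -> {morph B : x y / x + y} ->
  (forall x, exists c : R[i], A x = c *: B x) ->
  (forall w, exists x, ~ exists c : R[i], B x = c *: w) ->
  exists c : R[i], forall x, A x = c *: B x.
Proof.
move=> AD BD loc wide.
have [x0 Bx0] := wide 0.
have B0 : B x0 != 0 by apply/eqP => e; apply: Bx0; exists 0; rewrite e scaler0.
have [c0 Ax0] := loc x0.
have indep x : (~ exists c : R[i], B x = c *: B x0) -> A x = c0 *: B x.
  move=> Bx; have [c Ax] := loc x; have [d] := loc (x + x0).
  rewrite AD BD Ax Ax0 scalerDr => e.
  have e' : (c - d) *: B x = (d - c0) *: B x0.
    rewrite !scalerBl; apply/eqP; rewrite subr_eq addrAC -subr_eq opprK e.
    by rewrite addrC.
  have cd : c - d = 0.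
    apply/eqP/negPn/negP => cd0; apply: Bx; exists ((c - d)^-1 * (d - c0)).
    by rewrite -scalerA -e' scalerA mulVf// scale1r.
  move: e'; rewrite cd scale0r => /esym/eqP; rewrite scaler_eq0 (negbTE B0) orbF.
  rewrite subr_eq0 => /eqP <-; congr (_ *: _).
  by apply/eqP; rewrite -subr_eq0 cd.
exists c0 => x.
have [[d Bx]|] := pselect (exists c : R[i], B x = c *: B x0); last exact: indep.
have [x1 Bx1] := wide (B x0).
have h1 := indep _ Bx1.
have := indep (x + x1); rewrite AD BD h1 scalerDr => h.
apply: (addIr (c0 *: B x1)); apply: h => -[c e]; apply: Bx1; exists (c - d).
by rewrite scalerBl -e Bx addrC addKr.
Qed.

End RankOneGeometry.

(** * The two parametrisations of the rank-one operators *)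

Section RankOneModel.
Variables (R : realType).

(** The operators [x (x) f] are parametrised by the vector and then the functional,
or in the other order. The two cases of the theorem correspond to these two
orders, and treating the order as a parameter gives a single proof. *)
Record rank_one_model (X E F : normedModType R[i])
    (rho : E -> F -> 'B(X)) : Prop := {
  rho_addl : forall e e' f, rho (e + e') f = rho e f + rho e' f;
  rho_addr : forall e f f', rho e (f + f') = rho e f + rho e f';
  rho_scale : forall (a : R[i]) e f, rho (a *: e) f = rho e (a *: f);
  rho_norm : forall e f, rnorm (rho e f) = rnorm e * rnorm f;
  rho_rank : forall T, rank_le1 T <-> exists e f, T = rho e f;
  rho_rank2 : forall e f, e != 0 -> f != 0 ->
    exists e' f', ~ rank_le1 (rho e f' + rho e' f) }.

Lemma rank_one_model_flip (X E F : normedModType R[i]) (rho : E -> F -> 'B(X)) :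
  rank_one_model rho -> rank_one_model (fun f e => rho e f).
Proof.
move=> m; split.
- by move=> *; exact: rho_addr.
- by move=> *; exact: rho_addl.
- by move=> *; rewrite (rho_scale m).
- by move=> f e; rewrite (rho_norm m) mulrC.
- move=> T; rewrite (rho_rank m).
  by split=> -[a [b h]]; exists b, a.
- move=> f e f0 e0; have [e' [f' h]] := rho_rank2 m e0 f0.
  by exists f', e'; rewrite addrC.
Qed.

Lemma rank_one_model_tens (X : normedModType R[i]) : infinite_dimensional X ->
  rank_one_model (@tens R X X).
Proof.
move=> Xinf; split.
- by move=> *; exact: tens_addl.
- by move=> *; exact: tens_addr.
- by move=> *; exact: tens_scale.
- by move=> *; exact: rnorm_tens.
- by [].
move=> x0 f0 x00 f00; have off := infinite_dimensional_off_line Xinf.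
have [x1 hx1] := off x0.
have [a fa] := dual_neq0 f00.
have [z hz] := off a.
have z0 : z - (f0 z : R[i]) *: a != 0.
  by rewrite subr_eq0; apply/eqP => e; apply: hz; exists (f0 z).
have [f1 f1z] := exists_dual1 z0.
have f10 : f1 != 0.
  by apply/eqP => e; move/eqP: f1z; rewrite e op0 eq_sym oner_eq0.
exists x1, f1 => /(tens_add_rank_le1 x00 f10)[//|[c e]].
have : f0 (z - (f0 z : R[i]) *: a) = 0.
  by rewrite linearB/= dualZ fa mulr1 subrr.
rewrite e opZ -e f1z => /eqP; rewrite scaler_eq0 oner_eq0 orbF => /eqP c0.
by move/eqP: f00; rewrite e c0 scale0r.
Qed.

End RankOneModel.

(** * Additive isometries that are linear or conjugate linear *)

Section SemilinearIsometry.
Variables (R : realType) (V W : normedModType R[i]).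

(** The defect [D s = U (s x) - s U x] is additive in [s] and vanishes at integers,
so that [D (n s)], which is [n] times [D s], depends only on the fractional part
of [n s] and stays bounded as [n] grows. *)
Lemma additive_isometry_real (U : V -> W) : {morph U : x y / x + y} ->
  (forall x, rnorm (U x) = rnorm x) ->
  forall (r : R) x, U (r%:C *: x) = r%:C *: U x.
Proof.
move=> UD Un r x.
pose D s := U (s%:C *: x) - s%:C *: U x.
have DD s t : D (s + t) = D s + D t.
  by rewrite /D rmorphD/= !scalerDl UD opprD addrACA.
have Dle s : 0 <= s -> rnorm (D s) <= 2 * s * rnorm x.
  move=> s0; rewrite (le_trans (ler_rnormD _ _))// rnormN Un !rnorm_pscale// Un.
  by lra.
have D0 : D 0 = 0 by apply: (addrI (D 0)); rewrite -DD !addr0.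
have DN s : D (- s) = - D s.
  by apply/eqP; rewrite -addr_eq0 -DD addNr D0.
have D1 : D 1 = 0 by rewrite /D !scale1r subrr.
have Dn n : D n%:R = 0.
  by elim: n => [//|n IH]; rewrite -natr1 DD IH D1 addr0.
have DM n s : D (n%:R * s) = n%:R%:C *: D s.
  elim: n => [|n IH]; first by rewrite mul0r D0 scale0r.
  by rewrite -natr1 mulrDl mul1r DD IH rmorphD/= scalerDl scale1r.
have Dsmall s : 0 <= s -> rnorm (D s) <= 2 * rnorm x.
  move=> s0; have /andP[t1 t2] := truncn_itv s0.
  have -> : D s = D (s - (Num.truncn s)%:R) by rewrite DD DN Dn subr0.
  apply: (le_trans (Dle _ _)); first by rewrite subr_ge0.
  rewrite ler_wpM2r ?rnorm_ge0//; move: t2; rewrite -natr1; lra.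
have Dz s : 0 <= s -> D s = 0.
  move=> s0; apply/eqP; rewrite -rnorm_eq0; apply/eqP/le_anti.
  rewrite rnorm_ge0 andbT leNgt; apply/negP => p.
  have q : 0 <= 2 * rnorm x / rnorm (D s).
    by rewrite divr_ge0 ?mulr_ge0 ?rnorm_ge0.
  have /andP[_] := truncn_itv q; set n := (Num.truncn _).+1.
  rewrite ltr_pdivrMr// ltNge => /negP; apply.
  have := Dsmall _ (mulr_ge0 (ler0n R n) s0).
  by rewrite DM rnorm_pscale.
have Dr : D r = 0.
  have [r0|r0] := leP 0 r; first exact: Dz.
  by rewrite -[r]opprK DN Dz ?oppr0// oppr_ge0 ltW.
by apply/eqP; rewrite -subr_eq0; apply/eqP.
Qed.

(** Here [sigma] is going to be the identity or the conjugation. *)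
Record semilinear_isometry (sigma : R[i] -> R[i]) (U : V -> W) : Prop := {
  sli_add : {morph U : x y / x + y};
  sli_scale : forall a x, U (a *: x) = sigma a *: U x;
  sli_norm : forall x, rnorm (U x) = rnorm x;
  sli_onto : forall y, exists x, U x = y }.

Lemma cmod_i : cmod ('i : R[i]) = 1.
Proof.
apply/eqP; rewrite -(eqrXn2 (n := 2)) ?cmod_ge0 ?ler01// cmod_sqr/=.
by rewrite expr0n/= add0r.
Qed.

(** Comparing norms at [x] and at [x + i x] gives [|c| = 1] and [|1 + c| = |1 + i|],
hence [c = i] or [c = - i]. *)
Lemma additive_isometry_semilinear (U : V -> W) (c : R[i]) :
  (exists x : V, x != 0) ->
  {morph U : x y / x + y} -> (forall x, rnorm (U x) = rnorm x) ->
  (forall x, U ('i *: x) = c *: U x) ->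
  exists2 sigma : R[i] -> R[i], sigma = id \/ sigma = @conjc R &
    sigma 'i = c /\ forall a x, U (a *: x) = sigma a *: U x.
Proof.
move=> [x x0] UD Un Ui.
have xp : 0 < rnorm x by rewrite rnorm_gt0.
have c1 : cmod c = 1.
  apply: (mulIf (lt0r_neq0 xp)); rewrite -{1}(Un x) -rnorm_scale -Ui Un.
  by rewrite rnorm_scale cmod_i.
have c2 : cmod (1 + c) = cmod (1 + 'i : R[i]).
  apply: (mulIf (lt0r_neq0 xp)); rewrite -{1}(Un x) -!rnorm_scale.
  by rewrite scalerDl scale1r -Ui -UD Un scalerDl scale1r.
have Ure := additive_isometry_real UD Un.
have Uc a y : U (a *: y) = ((complex.Re a)%:C + (complex.Im a)%:C * c) *: U y.
  rewrite {1}(complexE a) scalerDl UD Ure mulrC -scalerA Ure Ui.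
  by rewrite scalerA -scalerDl.
have [h|h] : c = 'i \/ c = - 'i.
  have h1 : cmod c ^+ 2 = 1 by rewrite c1 expr1n.
  have h2 : cmod (1 + c) ^+ 2 = cmod (1 + 'i : R[i]) ^+ 2 by rewrite c2.
  move: h1 h2; rewrite !cmod_sqr; case: (c) => u v /= h1 h2.
  have u0 : u = 0 by move: h2; rewrite addr0 !add0r !expr1n; nra.
  rewrite u0 in h1 *; move: h1; rewrite expr0n/= add0r => /eqP.
  rewrite sqrf_eq1 => /orP[/eqP->|/eqP->]; [left|right] => //.
  by apply/eqP; rewrite eq_complex/= oppr0 !eqxx.
- exists id; [by left|split=> // a y].
  by rewrite Uc h {3}(complexE a) mulrC.
- exists (@conjc R); [by right|split=> [|a y]].
    by rewrite h; apply/eqP; rewrite eq_complex/= oppr0 !eqxx.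
  rewrite Uc h; congr (_ *: _); case: a => u v /=.
  by apply/eqP; rewrite eq_complex/=; apply/andP; split; apply/eqP; ring.
Qed.

End SemilinearIsometry.

(** * Isometric additive maps that preserve rank at most one *)

Section RankOnePreserver.
Variables (R : realType) (X Y : normedModType R[i]) (phi : 'B(X) -> 'B(Y)).
Hypotheses (phiD : forall S T, phi (S + T) = phi S + phi T)
  (phi_onto : forall S, exists T, phi T = S)
  (phi_norm : forall T, rnorm (phi T) = rnorm T)
  (phi_rank : forall T, rank_le1 (phi T) <-> rank_le1 T)
  (Y_wide : forall w : Y, exists y, ~ exists c : R[i], y = c *: w).

Section Model.
Variables (E F : normedModType R[i]) (rho : E -> F -> 'B(X)).
Hypothesis rhoP : rank_one_model rho.

Let phi_rho e f : rank_le1 (phi (rho e f)).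
Proof. by apply/phi_rank/(rho_rank rhoP); exists e, f. Qed.

Let phi_rho_eq0 e f : e != 0 -> f != 0 -> phi (rho e f) != 0.
Proof.
move=> e0 f0; rewrite -rnorm_gt0 phi_norm (rho_norm rhoP).
by rewrite mulr_gt0// rnorm_gt0.
Qed.

Let no_common_image e0 f0 y : e0 != 0 -> f0 != 0 ->
  (forall f, has_image y (phi (rho e0 f))) ->
  (forall e, has_image y (phi (rho e f0))) -> False.
Proof.
move=> e00 f00 h1 h2; have [e [f]] := rho_rank2 rhoP e00 f00.
by rewrite -phi_rank phiD; apply; apply: has_image_rank_le1; exact: has_imageD.
Qed.

Let no_common_kernel e0 f0 g : e0 != 0 -> f0 != 0 ->
  (forall f, has_kernel g (phi (rho e0 f))) ->
  (forall e, has_kernel g (phi (rho e f0))) -> False.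
Proof.
move=> e00 f00 h1 h2; have [e [f]] := rho_rank2 rhoP e00 f00.
by rewrite -phi_rank phiD; apply; apply: has_kernel_rank_le1; exact: has_kernelD.
Qed.

Definition image_kernel_type e0 f0 y0 g0 :=
  (forall f, has_image y0 (phi (rho e0 f))) /\
  (forall e, has_kernel g0 (phi (rho e f0))).

(** By [additive_rank_le1_family], fixing either parameter of [rho] gives a family of
operators with a common image or with a common kernel. The same alternative
cannot hold for both parameters, since [phi] reflects rank at most one and
[rho e f' + rho e' f] may have rank two. *)
Lemma rank_one_dichotomy e0 f0 y0 g0 : e0 != 0 -> f0 != 0 ->
  phi (rho e0 f0) = tens y0 g0 ->
  image_kernel_type e0 f0 y0 g0 \/
  ((forall e, has_image y0 (phi (rho e f0))) /\
   (forall f, has_kernel g0 (phi (rho e0 f)))).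
Proof.
move=> e00 f00 p0; have := phi_rho_eq0 e00 f00; rewrite p0 => t0.
have y00 : y0 != 0.
  by apply: contra t0 => /eqP->; rewrite -rnorm_eq0 rnorm_tens rnorm0 mul0r.
have g00 : g0 != 0.
  by apply: contra t0 => /eqP->; rewrite -rnorm_eq0 rnorm_tens rnorm0 mulr0.
have D1 : {morph (fun f => phi (rho e0 f)) : f f' / f + f'}.
  by move=> f f'; rewrite (rho_addr rhoP) phiD.
have D2 : {morph (fun e => phi (rho e f0)) : f f' / f + f'}.
  by move=> f f'; rewrite (rho_addl rhoP) phiD.
have [h1|h1] := additive_rank_le1_family D1 (phi_rho e0) y00 g00 p0;
have [h2|h2] := additive_rank_le1_family D2 (phi_rho^~ f0) y00 g00 p0.
- by case: (no_common_image e00 f00 h1 h2).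
- by left.
- by right.
- by case: (no_common_kernel e00 f00 h1 h2).
Qed.

(** The maps [U] and [C] are read off from [phi (rho e f0)] and [phi (rho e0 f)]. The
alternative of [rank_one_dichotomy] that holds at [e0, f0] propagates to the
other pairs, so that [phi (rho e f)] is a multiple of [tens (U e) (C f)]; the
factor is constant by [locally_scalar_additive], and so equal to its value 1 at
[e0]. The same lemma shows that [U (i e)] is a constant multiple of [U e]. *)
Lemma rank_one_preserver_normalised e0 f0 y0 g0 : e0 != 0 -> f0 != 0 ->
  phi (rho e0 f0) = tens y0 g0 -> rnorm y0 = rnorm e0 ->
  image_kernel_type e0 f0 y0 g0 ->
  exists sigma U C, [/\ sigma = id \/ sigma = @conjc R,
    semilinear_isometry sigma U, semilinear_isometry sigma C &
    forall e f, phi (rho e f) = tens (U e) (C f)].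
Proof.
move=> e00 f00 p0 ny0 [im ker].
have ng0 : rnorm g0 = rnorm f0.
  have := phi_norm (rho e0 f0); rewrite p0 rnorm_tens (rho_norm rhoP) ny0.
  by move/mulfI; apply; rewrite rnorm_eq0.
have y00 : y0 != 0 by rewrite -rnorm_eq0 ny0 rnorm_eq0.
have g00 : g0 != 0 by rewrite -rnorm_eq0 ng0 rnorm_eq0.
have [U UE] := choice ker; have [C CE] := choice im.
have UD : {morph U : e e' / e + e'}.
  move=> e e'; apply: (tens_injl g00).
  by rewrite -UE (rho_addl rhoP) phiD !UE tens_addl.
have CD : {morph C : f f' / f + f'}.
  move=> f f'; apply: (tens_injr y00).
  by rewrite -CE (rho_addr rhoP) phiD !CE tens_addr.
have Un e : rnorm (U e) = rnorm e.
  have := phi_norm (rho e f0); rewrite UE rnorm_tens (rho_norm rhoP) ng0.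
  by move/mulIf; apply; rewrite rnorm_eq0.
have Cn f : rnorm (C f) = rnorm f.
  have := phi_norm (rho e0 f); rewrite CE rnorm_tens (rho_norm rhoP) ny0.
  by move/mulfI; apply; rewrite rnorm_eq0.
have Ue0 : U e0 = y0 by apply: (tens_injl g00); rewrite -UE.
have Cf0 : C f0 = g0 by apply: (tens_injr y00); rewrite -CE.
have imU e f : e != 0 -> has_image (U e) (phi (rho e f)).
  move=> en0; have [[h _]|[_ h]] := rank_one_dichotomy en0 f00 (UE e) => //.
  by case: (no_common_kernel en0 f00 h ker).
have kerC e f : f != 0 -> has_kernel (C f) (phi (rho e f)).
  move=> fn0; have [[_ h]|[h _]] := rank_one_dichotomy e00 fn0 (CE f) => //.
  by case: (no_common_image e00 fn0 im h).
have U_line y : exists e c, y = (c : R[i]) *: U e.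
  have [->|yn0] := eqVneq y 0; first by exists 0, 0; rewrite scale0r.
  have [T phiT] := phi_onto (tens y g0).
  have /(rho_rank rhoP)[e [f Te]] : rank_le1 T.
    by apply/phi_rank; rewrite phiT; exact: rank_le1_tens.
  have en0 : e != 0.
    apply/eqP => ez; have := phi_norm T; rewrite {2}Te (rho_norm rhoP) ez.
    rewrite rnorm0 mul0r phiT rnorm_tens => /eqP.
    by rewrite mulf_eq0 !rnorm_eq0 (negbTE yn0) (negbTE g00).
  have [k] := imU e f en0; rewrite -Te phiT.
  by move/(tens_proportional g00) => [c yc]; exists e, c.
have U_wide w : exists e, ~ exists c : R[i], U e = c *: w.
  have [y hy] := Y_wide w; have [e [c ye]] := U_line y.
  by exists e => -[d Ue]; apply: hy; exists (c * d); rewrite ye Ue scalerA.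
have loc e y k : k != 0 -> has_image (U e) (tens y k) ->
    exists c : R[i], y = c *: U e.
  by move=> kn0 [k']; exact: tens_proportional.
have form e f : phi (rho e f) = tens (U e) (C f).
  have [->|fn0] := eqVneq f 0.
    have C0 : C 0 = 0 by apply/eqP; rewrite -rnorm_eq0 Cn rnorm0.
    apply/eqP; rewrite C0 -subr_eq0 -rnorm_eq0.
    have -> : tens (U e) (0 : dual Y) = 0.
      by apply/eqP; rewrite -rnorm_eq0 rnorm_tens rnorm0 mulr0.
    by rewrite subr0 phi_norm (rho_norm rhoP) rnorm0 mulr0.
  have Cfn0 : C f != 0 by rewrite -rnorm_eq0 Cn rnorm_eq0.
  have [A AE] := choice (fun e => kerC e f fn0).
  have AD : {morph A : e e' / e + e'}.
    move=> e1 e2; apply: (tens_injl Cfn0).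
    by rewrite -AE (rho_addl rhoP) phiD !AE tens_addl.
  have Aloc e1 : exists c : R[i], A e1 = c *: U e1.
    have [->|en0] := eqVneq e1 0; last first.
      by apply: (loc _ _ _ Cfn0); rewrite -AE; exact: imU.
    exists 0; rewrite scale0r; apply: (addrI (A 0)).
    by rewrite -AD !addr0.
  have [c AU] := locally_scalar_additive AD UD Aloc U_wide.
  have Ae0 : A e0 = y0 by apply: (tens_injl Cfn0); rewrite -AE CE.
  have c1 : c = 1.
    have := AU e0; rewrite Ae0 Ue0 => /eqP; rewrite -subr_eq0 -{1}[y0]scale1r.
    by rewrite -scalerBl scaler_eq0 (negbTE y00) orbF subr_eq0 => /eqP.
  by rewrite AE AU c1 scale1r.
have [c Ui] : exists c : R[i], forall e, U ('i *: e) = c *: U e.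
  apply: (locally_scalar_additive _ UD _ U_wide).
    by move=> e e'; rewrite scalerDr UD.
  move=> e; have [->|en0] := eqVneq e 0.
    by exists 1; rewrite scaler0 scale1r.
  by apply: (loc _ _ _ g00); rewrite -UE (rho_scale rhoP); exact: imU.
have nE : exists x : E, x != 0 by exists e0.
have nF : exists x : F, x != 0 by exists f0.
have [sigma sigmaE [si Us]] := additive_isometry_semilinear nE UD Un Ui.
have Ci f : C ('i *: f) = c *: C f.
  apply: (tens_injr y00); rewrite -CE -(rho_scale rhoP) form Ui Ue0.
  exact: tens_scale.
have [tau tauE [ti Cs]] := additive_isometry_semilinear nF CD Cn Ci.
have st : tau = sigma.
  have ne : 'i <> 'i^* :> R[i].
    move=> /eqP; rewrite eq_complex/= eqxx/= -subr_eq0 opprK.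
    by rewrite -[1 + 1]/(2%:R) pnatr_eq0.
  move: si ti; case: sigmaE => ->; case: tauE => -> //= <- e; exfalso; apply: ne => //.
have sigmaK a : sigma (sigma a) = a by case: sigmaE => ->//; rewrite conjcK.
rewrite st in Cs.
exists sigma, U, C; split=> //.
  split=> // y; have [e [d ye]] := U_line y.
  by exists (sigma d *: e); rewrite Us sigmaK.
split=> // g.
have [->|gn0] := eqVneq g 0.
  by exists 0; apply/eqP; rewrite -rnorm_eq0 Cn rnorm0.
have [T phiT] := phi_onto (tens y0 g).
have /(rho_rank rhoP)[e [f Te]] : rank_le1 T.
  by apply/phi_rank; rewrite phiT; exact: rank_le1_tens.
have := form e f; rewrite -Te phiT => h.
have [d y0d] := tens_proportional gn0 h.
have d0 : d != 0 by apply/eqP => d0; move/eqP: y00; rewrite y0d d0 scale0r.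
have Ue : U e = d^-1 *: y0 by rewrite y0d scalerA mulVf// scale1r.
exists (sigma d^-1 *: f); rewrite Cs sigmaK.
by apply/esym; apply: (tens_injr y00); rewrite h Ue tens_scale.
Qed.

Theorem rank_one_preserver_form e0 f0 y g : e0 != 0 -> f0 != 0 ->
  phi (rho e0 f0) = tens y g -> image_kernel_type e0 f0 y g ->
  exists sigma U C, [/\ sigma = id \/ sigma = @conjc R,
    semilinear_isometry sigma U, semilinear_isometry sigma C &
    forall e f, phi (rho e f) = tens (U e) (C f)].
Proof.
move=> e00 f00 pyg [im ker].
have y0 : y != 0.
  have := phi_rho_eq0 e00 f00; rewrite pyg; apply: contra => /eqP->.
  by rewrite -rnorm_eq0 rnorm_tens rnorm0 mul0r.
pose r := rnorm e0 / rnorm y.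
have r0 : 0 < r by rewrite divr_gt0// rnorm_gt0.
have c0 : r%:C != 0 :> R[i] by rewrite fmorph_eq0 gt_eqF.
have scale k : tens y k = tens (r%:C *: y) ((r%:C)^-1 *: k).
  by rewrite tens_scale scalerA divff// scale1r.
apply: (@rank_one_preserver_normalised e0 f0 (r%:C *: y) ((r%:C)^-1 *: g)) => //.
- by rewrite pyg scale.
- by rewrite rnorm_pscale ?(ltW r0)// divfK// rnorm_eq0.
split=> [f|e].
  by have [k ->] := im f; exists ((r%:C)^-1 *: k).
have [z ->] := ker e; exists (r%:C *: z).
by rewrite tens_scale scalerA divff// scale1r.
Qed.

End Model.

End RankOnePreserver.

Section SemilinearIsometryTheory.
Variables (R : realType) (V W : normedModType R[i]) (sigma : R[i] -> R[i]).
Hypothesis sigmaE : sigma = id \/ sigma = @conjc R.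

Lemma sigmaK : involutive sigma.
Proof. by case: sigmaE => -> a //; rewrite conjcK. Qed.

Lemma sigmaN1 : sigma (- 1) = - 1.
Proof.
by case: sigmaE => ->//; exact: rmorphN1.
Qed.

Lemma sigmaM a b : sigma (a * b) = sigma a * sigma b.
Proof. by case: sigmaE => ->//; exact: rmorphM. Qed.

Lemma cmod_sigma a : cmod (sigma a) = cmod a.
Proof. by case: sigmaE => ->//; exact: cmod_conj. Qed.

Lemma sli_isometric (U : V -> W) : semilinear_isometry sigma U -> isometric U.
Proof.
move=> sU x y; have UB : U (x - y) = U x - U y.
  by apply: (addIr (U y)); rewrite -(sli_add sU) !subrK.
by rewrite -UB -!rnormE (sli_norm sU).
Qed.

Lemma sli_inj (U : V -> W) : semilinear_isometry sigma U -> injective U.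
Proof.
move=> sU x y Uxy; apply/eqP; rewrite -subr_eq0 -normr_eq0.
by rewrite -(sli_isometric sU) Uxy subrr normr0.
Qed.

Lemma sli_inverse (U : V -> W) : semilinear_isometry sigma U ->
  exists U' : W -> V, [/\ semilinear_isometry sigma U', cancel U U' & cancel U' U].
Proof.
move=> sU; have [U' U'K] := choice (sli_onto sU).
have inj := sli_inj sU.
exists U'; split=> [|x|//]; last by apply: inj; rewrite U'K.
split.
- by move=> x y; apply: inj; rewrite (sli_add sU) !U'K.
- by move=> a x; apply: inj; rewrite (sli_scale sU) sigmaK !U'K.
- by move=> x; rewrite -(sli_norm sU) U'K.
- by move=> x; exists (U x); apply: inj; rewrite U'K.
Qed.

Lemma sli_bijective (U : V -> W) : semilinear_isometry sigma U -> bijective U.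
Proof. by move=> /sli_inverse[U' [_ ? ?]]; exists U'. Qed.

End SemilinearIsometryTheory.

Lemma sli_linear_or_conjugate (R : realType) (V W : normedModType R[i])
    (sigma : R[i] -> R[i]) (U : V -> W) (U' : W -> V) :
  sigma = id \/ sigma = @conjc R ->
  semilinear_isometry sigma U -> semilinear_isometry sigma U' ->
  (linear U /\ linear U') \/ (conjugate_linear U /\ conjugate_linear U').
Proof.
have lin (V1 V2 : normedModType R[i]) (A : V1 -> V2) :
    semilinear_isometry id A -> linear A.
  by move=> sA a x y; rewrite (sli_add sA) (sli_scale sA).
by case=> -> sU sU'; [left|right]; split;
  [exact: lin|exact: lin|split; [exact: sli_add sU|exact: sli_scale sU]|
   split; [exact: sli_add sU'|exact: sli_scale sU']].
Qed.

(** * From rank-one operators to all operators *)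

Section ModulusPreserver.
Variables (R : realType) (X Y : normedModType R[i]).
Variables (mu : 'B(X) -> R) (nu : 'B(Y) -> R) (phi : 'B(X) -> 'B(Y)).
Hypotheses (muP : modulus mu) (nuP : modulus nu)
  (phiD : forall S T, phi (S + T) = phi S + phi T)
  (phi_onto : forall S, exists T, phi T = S)
  (phi_mod : forall T, nu (phi T) = mu T).

(** By [modulus_norming] the norm is determined by the modulus and the addition. *)
Lemma modulus_preserver_norm T : rnorm (phi T) = rnorm T.
Proof.
have bound (Z : normedModType R[i]) (m : 'B(Z) -> R) : modulus m ->
    forall S A, m S - m (S + A) <= rnorm A.
  by move=> mP S A; have := modulus_lip mP S A; lra.
apply/le_anti/andP; split; rewrite leNgt; apply/negP => lt.
  have e0 : 0 < (rnorm (phi T) - rnorm T) / 2 by rewrite divr_gt0// subr_gt0.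
  have [S] := modulus_norming nuP (phi T) e0; have [S' <-] := phi_onto S.
  rewrite -phiD !phi_mod; have := bound _ _ muP S' T; lra.
have e0 : 0 < (rnorm T - rnorm (phi T)) / 2 by rewrite divr_gt0// subr_gt0.
have [S] := modulus_norming muP T e0.
rewrite -!phi_mod phiD; have := bound _ _ nuP (phi S) (phi T); lra.
Qed.

(** Rank at most one is determined by the modulus and the addition as well: by
[modulus_rank1] and [modulus_rank2], it means that no [T] of positive modulus has
[T + A] and [T + A + A] both of modulus zero. *)
Lemma modulus_preserver_rank_le1 T : rank_le1 (phi T) <-> rank_le1 T.
Proof.
split=> [[u [f phiT]]|[u [f Tuf]]]; apply: contrapT => h.
  have [S [S0 S1 S2]] := modulus_rank2 muP h.
  rewrite -phi_mod in S0; have := modulus_rank1 nuP u f S0.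
  by rewrite -phiT -!phiD !phi_mod S1 S2 ltxx; case.
have [S [S0 S1 S2]] := modulus_rank2 nuP h.
have [S' e] := phi_onto S; rewrite -e -!phiD !phi_mod in S0 S1 S2.
have := modulus_rank1 muP u f S0.
by rewrite -Tuf S1 S2 ltxx; case.
Qed.

(** In the two instances, [E] is [X] with the action of operators, or the dual of [X]
with the action of their adjoints; [F] is the other space and [b] is evaluation. *)
Record paired_model (E F : normedModType R[i]) (rho : E -> F -> 'B(X))
    (b : E -> F -> R[i]) (act : 'B(X) -> E -> E) : Prop := {
  paired_rank_one : rank_one_model rho;
  pairingZl : forall a e f, b (a *: e) f = a * b e f;
  pairingZ : forall e a f, b e (a *: f) = a * b e f;
  pairing_le : forall e f, cmod (b e f) <= rnorm e * rnorm f;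
  pairing_norm : forall e (M : R), 0 <= M ->
    (forall f, cmod (b e f) <= M * rnorm f) -> rnorm e <= M;
  pairing_sep : forall f, (forall e, b e f = 0) -> f = 0;
  actD : forall S T e, act (S + T) e = act S e + act T e;
  act0 : forall T, act T 0 = 0;
  act_scalar : forall a e, act (a *: idop X) e = a *: e;
  act_inverse : forall T S, inverse_pair T S -> cancel (act T) (act S);
  act_rank_one : forall T S e f, inverse_pair T S ->
    mu (T + rho e f) = 0 <-> b (act S e) f = - 1 }.

Section Representation.
Variables (E F : normedModType R[i]) (rho : E -> F -> 'B(X)).
Variables (b : E -> F -> R[i]) (act : 'B(X) -> E -> E).
Hypothesis rhoP : paired_model rho b act.
Variables (sigma : R[i] -> R[i]) (U : E -> Y) (C : F -> dual Y).
Hypotheses (sigmaE : sigma = id \/ sigma = @conjc R)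
  (sU : semilinear_isometry sigma U) (sC : semilinear_isometry sigma C)
  (phi_rho : forall e f, phi (rho e f) = tens (U e) (C f)).
Hypothesis shift : forall T : 'B(X),
  exists2 c : R[i], c != 0 & invertible (c *: idop X + T).

Let neq0_pre (V W : normedModType R[i]) (A : V -> W) y :
  semilinear_isometry sigma A -> y != 0 -> exists2 x, x != 0 & A x = y.
Proof.
move=> sA y0; have [x xy] := sli_onto sA y; exists x => //.
by rewrite -rnorm_eq0 -(sli_norm sA) xy rnorm_eq0.
Qed.

Let pairing_m1l e : e != 0 -> exists f, b e f = - 1.
Proof.
move=> e0; have [f bf] : exists f, b e f != 0.
  apply: contrapT => h; move/negP: e0; apply; rewrite -rnorm_eq0.
  apply/eqP/le_anti; rewrite rnorm_ge0 andbT; apply: (pairing_norm rhoP) => // f.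
  rewrite mul0r le_eqVlt cmod_eq0; apply/orP; left.
  by apply/negPn/negP => bf; apply: h; exists f.
by exists (- (b e f)^-1 *: f); rewrite (pairingZ rhoP) mulNr mulVf.
Qed.

Let pairing_m1r f : f != 0 -> exists e, b e f = - 1.
Proof.
move=> f0; have [e be] : exists e, b e f != 0.
  apply: contrapT => h; move/negP: f0; apply; apply/eqP/(pairing_sep rhoP) => e.
  by apply/eqP/negPn/negP => be; apply: h; exists e.
by exists (- (b e f)^-1 *: e); rewrite (pairingZl rhoP) mulNr mulVf.
Qed.

(* By homogeneity, a functional is determined by the set where it is -1. *)
Let semilinear_determined (p r : F -> R[i]) :
  (forall a f, p (a *: f) = a * p f) -> (forall a f, r (a *: f) = sigma a * r f) ->
  (forall f, p f = - 1 <-> r f = - 1) -> forall f, r f = sigma (p f).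
Proof.
move=> pZ rZ pr f; have m10 : (- 1 : R[i]) != 0 by rewrite oppr_eq0 oner_eq0.
have [pf|pf] := eqVneq (p f) 0.
  have s0 : sigma 0 = 0.
    by apply/eqP; rewrite -cmod_eq0 (cmod_sigma sigmaE) cmod0.
  rewrite pf s0; apply/eqP/negPn/negP => rf.
  have : r (sigma (- (r f)^-1) *: f) = - 1.
    by rewrite rZ (sigmaK sigmaE) mulNr mulVf.
  by rewrite -pr pZ pf mulr0 => /eqP; rewrite eq_sym (negbTE m10).
have : p (- (p f)^-1 *: f) = - 1 by rewrite pZ mulNr mulVf.
rewrite pr rZ => h.
have : sigma (- 1) = sigma (- (p f)^-1) * sigma (p f).
  by rewrite -(sigmaM sigmaE) mulNr mulVf.
rewrite (sigmaN1 sigmaE) -h => /mulfI -> //.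
by rewrite -cmod_eq0 (cmod_sigma sigmaE) cmod_eq0 oppr_eq0 invr_eq0.
Qed.

(* Both sides of [act_rank_one] make sense for [phi T] once it is known to be
   invertible, and [modulus_invertible] gives this because [U e] and [C f] run
   through all nonzero vectors and functionals. *)
Let image_invertible T S : inverse_pair T S ->
  exists Q, inverse_pair (phi T) Q /\
  forall e f, C f (Q (U e)) = sigma (b (act S e) f) :> R[i].
Proof.
move=> TS; have ST := inverse_pair_sym TS.
have eq0 e f : nu (phi T + tens (U e) (C f)) = 0 <-> b (act S e) f = - 1.
  by rewrite -phi_rho -phiD phi_mod; exact: (act_rank_one rhoP).
have [Q PQ] : invertible (phi T).
  apply: (modulus_invertible nuP).
  - by rewrite phi_mod; apply: (modulus_invertible_gt0 muP); exists S.
  - move=> y /(neq0_pre sU)[e e0 <-].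
    have Se0 : act S e != 0.
      by apply: contra e0 => /eqP e0; rewrite -(act_inverse rhoP ST e) e0 (act0 rhoP).
    have [f bf] := pairing_m1l Se0.
    by exists (C f); apply/eq0.
  - move=> g /(neq0_pre sC)[f f0 <-].
    have [e be] := pairing_m1r f0.
    by exists (U (act T e)); apply/eq0; rewrite (act_inverse rhoP TS).
exists Q; split=> // e; apply: semilinear_determined.
- by move=> a f; exact: (pairingZ rhoP).
- by move=> a f; rewrite (sli_scale sC).
- by move=> f; rewrite -eq0; exact: (modulus_rank1_eq0 nuP).
Qed.

(** For invertible [T] with inverse [S], the numbers [C f (phi T)^-1 (U e)] and
[b (act S e) f] determine each other, and this determines [(phi T)^-1 (U e)]; the
case of the identity defines [V] by [U V = phi 1]. A general operator is a
difference of two invertible ones. *)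
Theorem modulus_preserver_representation : exists2 V : Y -> E,
  semilinear_isometry sigma V & forall T y, phi T y = U (act T (V y)).
Proof.
have id_pair : inverse_pair (idop X) (idop X) by split.
have act_id e : act (idop X) e = e.
  by have := act_scalar rhoP 1 e; rewrite !scale1r.
have [Q0 [PQ CQ0]] := image_invertible id_pair.
have [W [sW UK WK]] := sli_inverse sigmaE sU.
pose V y := W (phi (idop X) y).
have UV y : U (V y) = phi (idop X) y by rewrite /V WK.
have CV f y : C f y = sigma (b (V y) f) :> R[i].
  by rewrite -(act_id (V y)) -CQ0 UV PQ.1.
have rep_inv T y : invertible T -> phi T y = U (act T (V y)).
  move=> [S TS]; have [Q [PQT CQ]] := image_invertible TS.
  have QU e : Q (U e) = Q0 (U (act S e)).
    apply/eqP; rewrite -subr_eq0; apply/eqP; apply: dual_sep => g.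
    have [f <-] := sli_onto sC g.
    by rewrite linearB/= CQ CQ0 act_id subrr.
  rewrite -[RHS](PQT.2) QU (act_inverse rhoP TS) UV PQ.1 //.
exists V.
  split.
  - by move=> x y; rewrite /V linearD/= (sli_add sW).
  - by move=> a x; rewrite /V linearZ/= (sli_scale sW).
  - move=> y; apply/le_anti/andP; split.
      apply: (pairing_norm rhoP) => [|f]; first exact: rnorm_ge0.
      rewrite -(cmod_sigma sigmaE) -CV mulrC.
      by rewrite -(sli_norm sC); exact: rnorm_apply.
    have [g g1 gy] := norming_functional y.
    have [f Cf] := sli_onto sC g.
    have := congr1 (fun a : R[i] => cmod a) gy.
    rewrite cmodR ger0_norm ?rnorm_ge0// => <-.
    rewrite -Cf CV (cmod_sigma sigmaE) (le_trans (pairing_le rhoP _ _))//.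
    by rewrite ler_piMr ?rnorm_ge0// -(sli_norm sC) Cf.
  - move=> e; exists (Q0 (U e)); rewrite /V PQ.2; exact: UK.
move=> T y; have [c c0 inv] := shift T.
have invc : invertible (c *: idop X) by eexists; exact: invertible_scalar.
have := rep_inv _ y inv; rewrite phiD opD (actD rhoP) (sli_add sU).
by rewrite (rep_inv _ y invc) => /addrI.
Qed.

End Representation.
End ModulusPreserver.

(** * Preservers of a modulus *)

Section Conclusion.
Variable R : realType.

Definition isometric_sandwich (X Y E : normedModType R[i])
    (act : 'B(X) -> E -> E) (phi : 'B(X) -> 'B(Y)) :=
  exists sigma (U : E -> Y) (V : Y -> E), [/\ sigma = id \/ sigma = @conjc R,
    semilinear_isometry sigma U, semilinear_isometry sigma V &
    forall T y, phi T y = U (act T (V y))].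

Lemma isometric_sandwichP (X Y E : normedModType R[i])
    (act : 'B(X) -> E -> E) (phi : 'B(X) -> 'B(Y)) :
  isometric_sandwich act phi -> exists (U : E -> Y) (V : Y -> E),
    [/\ bijective U /\ isometric U, bijective V /\ isometric V,
        (linear U /\ linear V) \/ (conjugate_linear U /\ conjugate_linear V) &
        forall T y, phi T y = U (act T (V y))].
Proof.
move=> [sigma [U [V [sE sU sV rep]]]]; exists U, V; split=> //.
- by split; [exact: (sli_bijective sE sU)|exact: (sli_isometric sU)].
- by split; [exact: (sli_bijective sE sV)|exact: (sli_isometric sV)].
- exact: (sli_linear_or_conjugate sE sU sV).
Qed.

Lemma infinite_dimensional_neq0 (Z : normedModType R[i]) :
  infinite_dimensional Z -> exists z : Z, z != 0.
Proof.
move=> /infinite_dimensional_off_line/(_ 0)[z hz]; exists z.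
by apply/eqP => z0; apply: hz; exists 0; rewrite z0 scaler0.
Qed.

Variables (X Y : completeNormedModType R[i]).
Variables (mu : 'B(X) -> R) (nu : 'B(Y) -> R).
Hypotheses (Xinf : infinite_dimensional X) (Yinf : infinite_dimensional Y).
Variable phi : 'B(X) -> 'B(Y).
Hypotheses (muP : modulus mu) (nuP : modulus nu)
  (phiD : forall S T, phi (S + T) = phi S + phi T)
  (phi_onto : forall S, exists T, phi T = S)
  (phi_mod : forall T, nu (phi T) = mu T).

Lemma paired_model_self :
  paired_model mu (@tens R X X) (fun x f => f x) (fun T x => T x).
Proof.
split.
- exact: rank_one_model_tens.
- by move=> a e f; rewrite dualZ.
- by [].
- by move=> x f; rewrite mulrC; exact: rnorm_apply.
- move=> x M M0 h; have [g g1 gx] := norming_functional x.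
  have := h g; rewrite gx cmodR ger0_norm ?rnorm_ge0// => /le_trans; apply.
  by rewrite ler_piMr.
- by move=> f h; apply: bounded_operator_eq => x; exact: h.
- by [].
- by move=> T; rewrite linear0.
- by [].
- by move=> T S [].
- by move=> T S e f TS; exact: (modulus_rank1_eq0 muP).
Qed.

Lemma paired_model_dual :
  paired_model mu (fun (f : dual X) x => tens x f) (fun f x => f x)
    (fun T f => adjoint T f).
Proof.
split.
- by apply: rank_one_model_flip; exact: rank_one_model_tens.
- by [].
- by move=> f a x; rewrite dualZ.
- by move=> f x; exact: rnorm_apply.
- by move=> f M M0 h; apply: rnorm_op_le.
- by move=> x h; apply: dual_sep.
- move=> S T f; apply: bounded_operator_eq => x.
  by rewrite adjointE opD linearD.
- by move=> T; apply: bounded_operator_eq => x.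
- by move=> a f; apply: bounded_operator_eq => x; rewrite adjointE opZ linearZ.
- by move=> T S [TS ST] f; apply: bounded_operator_eq => x; rewrite !adjointE ST.
- by move=> T S f x TS; rewrite adjointE; exact: (modulus_rank1_eq0 muP).
Qed.

Theorem modulus_preserver :
  isometric_sandwich (fun T (x : X) => T x) phi \/
  isometric_sandwich (fun T (f : dual X) => adjoint T f) phi.
Proof.
have pn := modulus_preserver_norm muP nuP phiD phi_onto phi_mod.
have pr := modulus_preserver_rank_le1 muP nuP phiD phi_onto phi_mod.
have yw := infinite_dimensional_off_line Yinf.
have [x0 x00] := infinite_dimensional_neq0 Xinf; have [f0 f0x] := exists_dual1 x00.
have f00 : f0 != 0.
  by apply/eqP => e; move/eqP: f0x; rewrite e op0 eq_sym oner_eq0.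
have [y [g pyg]] : rank_le1 (phi (tens x0 f0)).
  by apply/pr; exact: rank_le1_tens.
have mT := rank_one_model_tens Xinf.
have mF := rank_one_model_flip mT.
have shift := @invertible_shift R X.
have [h|[h1 h2]] := rank_one_dichotomy phiD pn pr mT x00 f00 pyg.
  left; have [sigma [U [C [sE sU sC form]]]] :=
    rank_one_preserver_form phiD phi_onto pn pr yw mT x00 f00 pyg h.
  have [V sV rep] := modulus_preserver_representation muP nuP phiD phi_mod
    paired_model_self sE sU sC form shift.
  by exists sigma, U, V.
right; have [sigma [U [C [sE sU sC form]]]] :=
  rank_one_preserver_form phiD phi_onto pn pr yw mF f00 x00 pyg (conj h1 h2).
have [V sV rep] := modulus_preserver_representation muP nuP phiD phi_mod
  paired_model_dual sE sU sC form shift.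
by exists sigma, U, V.
Qed.

End Conclusion.

Unset Implicit Arguments.

Theorem theorem3p1 (R : realType) (X Y : completeNormedModType R[i])
  (X_infdim : infinite_dimensional X) (Y_infdim : infinite_dimensional Y)
  (phi : 'B(X) -> 'B(Y))
  (phi_additive : forall S T : 'B(X), phi (S + T) = phi S + phi T)
  (phi_surjective : forall S : 'B(Y), exists T : 'B(X), phi T = S)
  (phi_preserves :
    (forall T : 'B(X), minimum_modulus (phi T) = minimum_modulus T) \/
    (forall T : 'B(X), surjectivity_modulus (phi T) = surjectivity_modulus T)) :
  (exists (U : X -> Y) (V : Y -> X),
    [/\ bijective U /\ isometric U,
        bijective V /\ isometric V,
        (linear U /\ linear V) \/ (conjugate_linear U /\ conjugate_linear V) &
        forall (T : 'B(X)) (y : Y), phi T y = U (T (V y))])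
  \/
  (exists (U : dual X -> Y) (V : Y -> dual X),
    [/\ bijective U /\ isometric U,
        bijective V /\ isometric V,
        (linear U /\ linear V) \/ (conjugate_linear U /\ conjugate_linear V) &
        forall (T : 'B(X)) (y : Y), phi T y = U (adjoint T (V y))]).
Proof.
have nX := infinite_dimensional_neq0 X_infdim.
have nY := infinite_dimensional_neq0 Y_infdim.
have [h|h] : isometric_sandwich (fun T (x : X) => T x) phi \/
    isometric_sandwich (fun T (f : dual X) => adjoint T f) phi.
- case: phi_preserves => phi_mod.
    exact: (modulus_preserver X_infdim Y_infdim (modulus_minimum nX)
      (modulus_minimum nY) phi_additive phi_surjective phi_mod).
  exact: (modulus_preserver X_infdim Y_infdim (modulus_surjectivity nX)
    (modulus_surjectivity nY) phi_additive phi_surjective phi_mod).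
- by left; exact: isometric_sandwichP h.
- by right; exact: isometric_sandwichP h.
Qed.
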